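(* Let $d\ge 2$ be a constant integer and let $\varepsilon>0$. There exist constants $c,C>0$ and $n_0$ depending only on $d$ and $\varepsilon$ such that the following holds for all $n\ge n_0$. Let $\mathbf d=(t_1,t_2,\dots,t_n)$ be a degree sequence of some $n$-vertex simple graph with $2\le t_i\le d$ for all $i$, and such that $m_{\mathbf d}:=\frac12\sum_{i=1}^n t_i\ge(1+\varepsilon)n$. Let $\mathbb{E}[F^s_{\mathbf d}]$ be the average number of faces in a random embedding of a random simple graph with degree sequence $\mathbf d$. Then $c\log n\le\mathbb{E}[F^s_{\mathbf d}]\le C\log n$, i.e. $\mathbb{E}[F^s_{\mathbf d}]=\Theta(\log n)$.
   Context: A random simple graph with degree sequence $\mathbf d$ is a uniformly random element of the set of simple graphs on vertices $v_1,\dots,v_n$ in which $v_i$ has degree $t_i$. A random embedding of a graph is given by choosing independently and uniformly, for each vertex $v$, a cyclic permutation $R_v$ (a single cycle) of the darts at $v$, where a dart is a pair $(v,e)$ with $e$ an edge incident with $v$. With $R$ the product of all $R_v$ and $L$ the involution on darts swapping the two darts of each edge, the number of faces is the number of cycles of $R\circ L$. Equivalently: fix a set of $2m_{\mathbf d}$ darts and a permutation $R$ of it with one cycle of length $t_i$ for each $i$, choose $L$ uniformly among all fixed-point-free involutions of the darts such that the resulting graph (vertices are the cycles of $R$, edges are the 2-cycles of $L$) is simple, and count the cycles of $R\circ L$. *)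

(* Defs.v *)
From HB Require Import structures.
From mathcomp Require Import all_boot all_order all_algebra all_fingroup.
From mathcomp Require Import reals.
Set Implicit Arguments.
Unset Strict Implicit.
Unset Printing Implicit Defensive.
Import Order.TTheory GRing.Theory Num.Theory.
Local Open Scope ring_scope.

(* A graph on the vertices 'I_n is given by its edge set E. *)
Definition simple_graph (n : nat) (E : {set {set 'I_n}}) : bool :=
  [forall e in E, #|e| == 2%N].

Definition degree (n : nat) (E : {set {set 'I_n}}) (v : 'I_n) : nat :=
  #|[set e in E | v \in e]|.

Definition graphs_with_degrees (n : nat) (t : 'I_n -> nat) :
    {set {set {set 'I_n}}} :=
  [set E | simple_graph E & [forall v, degree E v == t v]].

Definition graphical (n : nat) (t : 'I_n -> nat) : Prop :=
  exists E : {set {set 'I_n}}, E \in graphs_with_degrees t.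

(* All pairs (v, e), whether or not they are darts of a given graph: the darts
   of every graph on 'I_n form a set in this one type, so that permutations of
   darts are permutations of this type. *)
Definition vpair (n : nat) : finType := ('I_n * {set 'I_n})%type.

Definition darts (n : nat) (E : {set {set 'I_n}}) : {set vpair n} :=
  [set x : vpair n | x.2 \in E & x.1 \in x.2].

Definition darts_at (n : nat) (E : {set {set 'I_n}}) (v : 'I_n) :
    {set vpair n} :=
  [set x in darts E | x.1 == v].

Definition single_cycle_on (T : finType) (A : {set T}) (s : {perm T}) : bool :=
  perm_on A s && [forall x in A, porbit s x == A].

(* The choices (R_v)_v; the uniform distribution on this set is that of
   independent uniform R_v. *)
Definition rotation_systems (n : nat) (E : {set {set 'I_n}}) :
    {set {ffun 'I_n -> {perm vpair n}}} :=
  [set rho : {ffun 'I_n -> {perm vpair n}} |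
    [forall v, single_cycle_on (darts_at E v) (rho v)]].

(* (v, {v, w}) |-> (w, {v, w}); other pairs are fixed. *)
Definition swap_ends (n : nat) (x : vpair n) : vpair n :=
  if (#|x.2| == 2%N) && (x.1 \in x.2)
  then (odflt x.1 [pick w in x.2 :\ x.1], x.2) else x.

Lemma swap_endsE (n : nat) (v w : 'I_n) :
  v != w -> swap_ends (v, [set v; w]) = (w, [set v; w]).
Proof.
move=> vw; rewrite /swap_ends /= cards2 vw eqxx !inE eqxx /=.
case: pickP => [u|/(_ w)] /=; rewrite !inE; last by rewrite eq_sym vw eqxx orbT.
by case: (u == v) => //= /eqP ->.
Qed.

Lemma swap_endsK (n : nat) : involutive (@swap_ends n).
Proof.
move=> [v e]; have [/andP[]|/negbTE ne] := boolP ((#|e| == 2%N) && (v \in e)).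
  move=> /cards2P[a [b [ab ->]]]; rewrite in_set2 => /orP[] /eqP->.
    by rewrite swap_endsE // setUC swap_endsE // eq_sym.
  by rewrite setUC swap_endsE 1?eq_sym // setUC swap_endsE.
have h : swap_ends (v, e) = (v, e) by rewrite /swap_ends [_ && _]ne.
by rewrite !h.
Qed.

Definition dart_swap (n : nat) : {perm vpair n} :=
  perm (inv_inj (@swap_endsK n)).

Lemma dart_swap_darts (n : nat) (E : {set {set 'I_n}}) (x : vpair n) :
  simple_graph E -> x \in darts E ->
  [/\ dart_swap n x \in darts E, dart_swap n x != x & (dart_swap n x).2 = x.2].
Proof.
case: x => v e /forall_inP simE; rewrite !permE inE /= => /andP[eE].
have /cards2P[a [b [ab eab]]] := simE e eE; move: eE; rewrite {}eab => eE.
have ba : b != a by rewrite eq_sym.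
rewrite in_set2 => /orP[] /eqP->.
  by rewrite swap_endsE // inE /= eE in_set2 eqxx orbT xpair_eqE (negbTE ba).
move: eE; rewrite setUC => eE.
by rewrite swap_endsE // inE /= eE in_set2 eqxx orbT xpair_eqE (negbTE ab).
Qed.

(* In {perm _}, (s * t) x = t (s x), so dart_swap n * R is R \o dart_swap n. *)
Definition num_faces (n : nat) (E : {set {set 'I_n}})
    (rho : {ffun 'I_n -> {perm vpair n}}) : nat :=
  #|[set porbit (dart_swap n * \prod_(v < n) rho v)%g x | x in darts E]|.

Definition average (R : realType) (T : finType) (A : {set T}) (f : T -> R) : R :=
  (\sum_(x in A) f x) / #|A|%:R.

Definition expected_faces (R : realType) (n : nat) (t : 'I_n -> nat) : R :=
  average (graphs_with_degrees t)
    (fun E => average (rotation_systems E) (fun rho => (num_faces E rho)%:R)).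

Definition half_degree_sum (R : realType) (n : nat) (t : 'I_n -> nat) : R :=
  (\sum_(i < n) t i)%N%:R / 2.

(* Main.v *)
From HB Require Import structures.
Require Import Defs.
From mathcomp Require Import all_boot all_order all_algebra all_fingroup.
From mathcomp Require Import reals sequences exp.
From mathcomp Require Import ring lra zify.
Set Implicit Arguments.
Unset Strict Implicit.
Unset Printing Implicit Defensive.
Import Order.TTheory GRing.Theory Num.Theory.

(* In the configuration model, a uniform matching L of a set of darts is exposed
   one pair at a time, keeping the permutation pi that the partially exposed
   faces induce on the unmatched darts.  If x is not fixed by pi, then pairing x
   with a uniform y closes a face exactly for y = pi x and y = pi^-1 x.  With
   2j + 2 darts left this has probability of order 1 / (2j + 1), which gives
   E[F] = O(log n) and E[exp (- F)] <= exp (- c log n); fixed points of pi are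
   controlled by a potential.  A switching argument shows that a uniform matching
   is simple with probability bounded below, so both bounds survive conditioning
   on simplicity, the lower one through Jensen's inequality for exp (- F). *)

(** * Exposing one pair of a random matching *)

(** Fixed points of [pi] are the obstacle to the upper bound: pairing two of them always closes a
    face, so linearly many could give linearly many faces. A weight of 1/2 on each pays for that
    face in advance, and exposing a dart [x] that is not fixed, while there is one, raises closed
    faces plus weight by at most 3 / (2j + 1) on average. The weight starts at 0 because all degrees
    are at least 2. The lower bound needs no potential: for a suitable [x] some partner always
    closes a face. Conditioning on an event of probability at least 1 / [C0] multiplies the mean of
    a nonnegative variable by at most [C0]. This carries over upper bounds only, which is why the
    lower bound is phrased as an upper bound for [exp (- F)]. The theorem averages over graphs and
    rotations, the estimates over matchings with [rotation] fixed. Labellings link the two: a simple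
    matching amounts to a graph whose darts are named by model darts, such a naming carries exactly
    one rotation system, and each rotation system is carried by the same number of namings. *)

Section Splice.
Local Open Scope ring_scope.
Variable T : finType.
Implicit Types (s pi L : {perm T}) (U : {set T}) (x y z : T).

(** Takes [x] out of its cycle, joining its predecessor to its successor, and leaves [x] as a fixed
    point. *)
Definition splice s x : {perm T} := (s * tperm x (s x))%g.

Lemma spliceE s x z :
  splice s x z = if z == x then x else if s z == x then s x else s z.
Proof.
rewrite permM; have [->|zx] := eqVneq z x; first by rewrite tpermR.
have [->|szx] := eqVneq (s z) x; first by rewrite tpermL.
by rewrite tpermD // eq_sym // (inj_eq perm_inj).
Qed.

(** Moved to the left factor, the transposition exchanges [s^-1 x] and [x], two points of one cycle;
    it splits that cycle unless the two points coincide. *)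
Lemma porbits_splice s x :
  #|porbits (splice s x)| = (#|porbits s| + (s x != x))%N.
Proof.
have -> : splice s x = (tperm (s^-1%g x) x * s)%g.
  by rewrite (conjgC (tperm _ _)) tpermJ permKV.
have := porbits_mul_tperm s (s^-1%g x) x.
rewrite -porbitV porbit_sym; have := mem_porbit s^-1 1 x.
rewrite expg1 porbit_sym => -> /=; rewrite addn0 => ->.
by rewrite -(inj_eq (@perm_inj _ s)) permKV eq_sym.
Qed.

(* For [L] fixing [x] and [y], [L * contract pi x y] is the permutation induced by
   [L * tperm x y * pi] on the complement of [x] and [y], see [contract_porbits]. *)
Definition contract pi x y : {perm T} :=
  splice (splice (tperm x y * pi)%g x) y.

(** The cycles of [tperm x y * pi] contained in {x, y}: the singleton of [x], the singleton of [y],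
    and the 2-cycle that arises when [pi] fixes both. *)
Definition closed_faces pi x y : nat :=
  (pi y == x) + (pi x == y) + ((pi x == x) && (pi y == y)).

Lemma contract_fixL pi x y : x != y -> contract pi x y x = x.
Proof.
by move=> xy; rewrite spliceE (negbTE xy) !spliceE !eqxx (negbTE xy).
Qed.

Lemma contract_fixR pi x y : contract pi x y y = y.
Proof. by rewrite spliceE eqxx. Qed.

Lemma tperm_mulE pi x y z : (tperm x y * pi)%g z =
  if z == x then pi y else if z == y then pi x else pi z.
Proof. by rewrite permM; case: tpermP => [->|->|/eqP/negbTE-> /eqP/negbTE->];
  rewrite ?eqxx //; case: eqP => // ->. Qed.

(** Each of the two splices gains one cycle unless its point is already fixed at that moment; the
    shortfall from 2 is [closed_faces]. *)
Lemma contract_porbits pi x y L : x != y -> L x = x -> L y = y ->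
  (#|porbits (L * tperm x y * pi)%g| + 2 =
   #|porbits (L * contract pi x y)%g| + closed_faces pi x y)%N.
Proof.
move=> xy Lx Ly.
have commute s z : L z = z -> (L * splice s z)%g = splice (L * s) z.
  by move=> Lz; rewrite /splice permM Lz mulgA.
rewrite /contract !commute // !porbits_splice mulgA.
have yx : y != x by rewrite eq_sym.
rewrite spliceE (negbTE yx) -!mulgA !permM Lx Ly.
rewrite tpermL tpermR /closed_faces.
have [pxx|_] := eqVneq (pi x) x; last by case: (pi y == x); case: (pi x == y); lia.
have -> : (pi y == x) = false by apply: contraNF yx => /eqP pyx; apply/eqP/(@perm_inj _ pi); rewrite pyx.
by rewrite pxx (negbTE xy); case: (pi y == y); lia.
Qed.

Lemma contract_on pi U x y : x \in U -> y \in U -> x != y ->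
  perm_on U pi -> perm_on (U :\ x :\ y) (contract pi x y).
Proof.
move=> xU yU xy piU; apply/subsetP => z; rewrite inE => cz.
have zy : z != y by apply: contraNneq cz => ->; rewrite contract_fixR.
have zx : z != x by apply: contraNneq cz => ->; rewrite contract_fixL.
rewrite !inE zx zy /=; apply: contraNT cz => zU.
have pz := out_perm piU zU.
rewrite !spliceE !tperm_mulE !eqxx (negbTE zx) (negbTE zy) pz.
by rewrite (negbTE zx) (negbTE zy).
Qed.

Definition matchings U : {set {perm T}} :=
  [set L : {perm T} | perm_on U L & [forall x in U, (L x != x) && (L (L x) == x)]].

Lemma matchings_add U x y L : x \in U -> y \in U :\ x ->
  ((L * tperm x y)%g \in matchings U) && ((L * tperm x y)%g x == y)
  = (L \in matchings (U :\ x :\ y)).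
Proof.
move=> xU; rewrite in_setD1 => /andP[yx yU].
rewrite !inE; apply/idP/idP.
  move=> /andP[/andP[LU /forall_inP Lm]]; rewrite permM => /eqP Lx.
  have {}Lx : L x = x by apply: (@perm_inj _ (tperm x y)); rewrite Lx tpermL.
  have Ly : L y = y.
    have /andP[_ /eqP] := Lm _ xU; rewrite !permM Lx tpermL => Ly.
    by apply: (@perm_inj _ (tperm x y)); rewrite Ly tpermR.
  have E z : z != x -> z != y -> (L * tperm x y)%g z = L z.
    move=> zx zy; rewrite permM tpermD // eq_sym.
      by rewrite -{1}Lx (inj_eq perm_inj).
    by rewrite -{1}Ly (inj_eq perm_inj).
  apply/andP; split.
    apply/subsetP=> z; rewrite inE => Lz.
    have zy : z != y by apply: contraNneq Lz => ->; rewrite Ly.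
    have zx : z != x by apply: contraNneq Lz => ->; rewrite Lx.
    by rewrite !inE zx zy /=; apply: (subsetP LU); rewrite inE E.
  apply/forall_inP=> z; rewrite !inE => /and3P[zy zx zU].
  have := Lm z zU; rewrite (E z) // E //.
    by rewrite -{1}Lx (inj_eq perm_inj).
  by rewrite -{1}Ly (inj_eq perm_inj).
move=> /andP[LU /forall_inP Lm].
have Lx : L x = x by apply: (out_perm LU); rewrite !inE eqxx andbF.
have Ly : L y = y by apply: (out_perm LU); rewrite !inE eqxx.
have E z : z != x -> z != y -> (L * tperm x y)%g z = L z.
  move=> zx zy; rewrite permM tpermD // eq_sym.
    by rewrite -{1}Lx (inj_eq perm_inj).
  by rewrite -{1}Ly (inj_eq perm_inj).
rewrite permM Lx tpermL eqxx andbT; apply/andP; split.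
  apply: perm_onM.
    by apply: subset_trans LU _; rewrite setDDl subsetDl.
  by apply: subset_trans (tperm_on x y) _; apply/subsetP => z;
    rewrite !inE => /orP[]/eqP->.
apply/forall_inP=> z zU.
have [->|zx] := eqVneq z x.
  by rewrite !permM Lx tpermL Ly tpermR eqxx andbT.
have [->|zy] := eqVneq z y.
  by rewrite !permM Ly tpermR Lx tpermL eqxx eq_sym yx.
rewrite (E z) // E; last 2 first.
  by rewrite -{1}Lx (inj_eq perm_inj).
  by rewrite -{1}Ly (inj_eq perm_inj).
by apply: Lm; rewrite !inE zx zy.
Qed.

(** The exposure step: the partner of [x] is revealed first, and given it the rest is an arbitrary
    matching of the remaining points. *)
Lemma big_matchings (R : nmodType) U x (f : {perm T} -> R) : x \in U ->
  \sum_(L in matchings U) f L =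
  \sum_(y in U :\ x) \sum_(L in matchings (U :\ x :\ y)) f (L * tperm x y)%g.
Proof.
move=> xU; rewrite (partition_big (fun L : {perm T} => L x) (mem (U :\ x))) /=.
  apply: eq_bigr => y yU.
  rewrite (reindex_onto (fun L => L * tperm x y)%g (fun L => L * tperm x y)%g).
    apply: eq_bigl => L; rewrite -mulgA tperm2 mulg1 eqxx andbT.
    exact: matchings_add.
  by move=> L _; rewrite -mulgA tperm2 mulg1.
move=> L; rewrite !inE => /andP[LU /forall_inP/(_ _ xU)/andP[-> _]].
by rewrite (perm_closed _ LU).
Qed.

Lemma matchings0 : matchings set0 = [set 1%g].
Proof.
apply/setP=> L; rewrite !inE; apply/andP/eqP => [[L0 _]|->].
  by apply: (perm_on_id L0); rewrite cards0.
by split; [exact: perm_on1 | apply/forall_inP=> x; rewrite inE].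
Qed.

Lemma cardsD2 U x y : x \in U -> y \in U :\ x -> (#|U :\ x :\ y|.+2 = #|U|)%N.
Proof. by move=> xU yU; rewrite (cardsD1 x U) xU (cardsD1 y (U :\ x)) yU. Qed.

(** The double factorial (2k - 1)!!. *)
Definition odd_fact k := (\prod_(j < k) j.*2.+1)%N.

Lemma card_matchings k U : #|U| = k.*2 -> #|matchings U| = odd_fact k.
Proof.
elim: k U => [|k IH] U Uk.
  by rewrite (cards0_eq Uk) matchings0 cards1 /odd_fact big_ord0.
have /card_gt0P[x xU] : (0 < #|U|)%N by rewrite Uk.
have := big_matchings (fun=> 1%N) xU; rewrite !sum1_card => ->.
under eq_bigr => y yU.
  rewrite sum1_card IH; last first.
    by have := cardsD2 xU yU; rewrite Uk doubleS => -[].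
  over.
rewrite sum_nat_const /odd_fact big_ord_recr /= mulnC; congr (_ * _)%N.
by have := cardsD1 x U; rewrite xU Uk doubleS => -[].
Qed.

Definition fixed pi U := [set z in U | pi z == z].

(** A point becomes fixed when its path through the paired darts returns to it. Through [x] alone
    this forces [pi (pi y) = x], through [y] alone [y = pi (pi x)]. Through both it forces
    [pi y = y], and then the gain is offset by [y] leaving the fixed points. *)
Lemma card_fixed_contract pi U x y :
  y \in U :\ x -> pi x != x ->
  (#|fixed (contract pi x y) (U :\ x :\ y)| <=
   #|fixed pi U| + (pi (pi y) == x) + (y == pi (pi x)))%N.
Proof.
rewrite in_setD1 => /andP[yx yU] pxx.
pose cond (b : bool) z : {set T} := if b then [set z] else set0.
have card_cond b z : #|cond b z| = b.
  by rewrite /cond; case: b; rewrite ?cards1 ?cards0.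
have sub : fixed (contract pi x y) (U :\ x :\ y) \subset
    (fixed pi U :\ y) :|: cond (pi y == y) (pi x) :|:
    cond (pi (pi y) == x) (pi y) :|: cond (y == pi (pi x)) (pi x).
  apply/subsetP=> z; rewrite !inE -!andbA => /and4P[zy zx zU].
  rewrite !spliceE !tperm_mulE !eqxx (negbTE zx) (negbTE zy) (negbTE yx) zU.
  rewrite (negbTE pxx) /=.
  have [pz|_] := eqVneq (pi z) x.
    have [pyy|_] := eqVneq (pi y) y => [/eqP <-|/eqP pyz].
      by rewrite /cond inE eqxx ?orbT.
    by rewrite pyz pz eqxx /cond inE eqxx ?orbT.
  have [pzy|_] := eqVneq (pi z) y => [/eqP pxz|/eqP ->]; last by rewrite eqxx.
  by rewrite pxz pzy eqxx /cond inE eqxx ?orbT.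
have yA : (y \in fixed pi U) = (pi y == y) by rewrite inE yU.
apply: leq_trans (subset_leq_card sub) _.
do 2 (apply: leq_trans (leq_card_setU _ _) _; rewrite card_cond leq_add2r).
by apply: leq_trans (leq_card_setU _ _) _; rewrite card_cond (cardsD1 y (fixed pi U)) yA addnC.
Qed.

Lemma sum_eq_le1 (A : {set T}) z (f : T -> T) : injective f ->
  (\sum_(y in A) (f y == z) <= 1)%N.
Proof.
move=> fI; rewrite -big_mkcondr /= sum1_card.
have [y0 /andP[_ /eqP y0z]|/eq_card0->//] := pickP (fun y => (y \in A) && (f y == z)).
rewrite -(card1 y0); apply: subset_leq_card; apply/subsetP => y.
by rewrite unfold_in => /andP[_ /eqP yz]; rewrite inE; apply/eqP/fI; rewrite yz.
Qed.

(* The 6 comes from two choices of [y] that close a face (counted doubly) and two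
   that create a new fixed point. *)
Lemma sum_potential pi U x : x \in U -> pi x != x ->
  (\sum_(y in U :\ x) (#|fixed (contract pi x y) (U :\ x :\ y)| +
     (closed_faces pi x y).*2) <= #|U :\ x| * #|fixed pi U| + 6)%N.
Proof.
move=> xU pxx.
pose e f z := (\sum_(y in U :\ x) ((f : T -> T) y == z))%N.
have piI := @perm_inj _ pi.
apply: (@leq_trans (#|U :\ x| * #|fixed pi U| +
  (e (pi \o pi) x + e id (pi (pi x)) + (e pi x + e id (pi x)).*2))%N); last first.
  have := sum_eq_le1 (U :\ x) x (inj_comp piI piI).
  have := sum_eq_le1 (U :\ x) (pi (pi x)) (@inj_id T).
  have := sum_eq_le1 (U :\ x) (pi x) (@inj_id T).
  have := sum_eq_le1 (U :\ x) x piI.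
  rewrite -!/(e _ _); lia.
rewrite -sum_nat_const /e -!muln2 -!big_split big_distrl /= -!big_split /=.
apply: leq_sum => y yU; rewrite /closed_faces (negbTE pxx) addn0 (eq_sym (pi x)).
have := card_fixed_contract yU pxx; lia.
Qed.

Lemma closed_faces_fixed pi x y : x != y -> pi x = x -> pi y = y ->
  closed_faces pi x y = 1%N.
Proof.
move=> xy px py.
by rewrite /closed_faces px py !eqxx eq_sym (negbTE xy).
Qed.

Lemma in_matchings_fix U x y L : L \in matchings (U :\ x :\ y) ->
  L x = x /\ L y = y.
Proof.
rewrite inE => /andP[LU _].
by split; apply: (out_perm LU); rewrite !inE eqxx ?andbF.
Qed.

(** * Moments of the number of cycles for a uniform matching *)

Section Sums.
Variable R : realFieldType.

Definition harmonic_odd k : R := \sum_(j < k) (j.*2.+1)%:R^-1.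

(** Points outside [U] are singleton cycles of [L * pi], whence [#|~: U|]. The 3 is half of the 6 in
    [sum_potential], since the potential there is doubled. *)
Lemma sum_porbits_le k pi U : #|U| = k.*2 -> perm_on U pi ->
  \sum_(L in matchings U) #|porbits (L * pi)|%:R <=
  (odd_fact k)%:R * (#|~: U|%:R + 3 * harmonic_odd k + #|fixed pi U|%:R / 2).
Proof.
elim: k pi U => [|k IH] pi U Uk piU.
  rewrite (cards0_eq Uk) matchings0 big_set1 mul1g.
  rewrite /odd_fact /harmonic_odd !big_ord0.
  have -> : pi = 1%g by apply: (perm_on_id piU); rewrite Uk.
  rewrite mulr0 addr0 mul1r setC0 cardsT.
  have le : (#|porbits (1 : {perm T})%g| <= #|T|)%N by apply: leq_imset_card.
  have : (0 : R) <= #|fixed (1 : {perm T})%g set0|%:R / 2 by rewrite divr_ge0 // ler0n.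
  have : (#|porbits (1 : {perm T})%g|%:R : R) <= #|T|%:R by rewrite ler_nat.
  lra.
pose pot x y := (#|fixed (contract pi x y) (U :\ x :\ y)| + (closed_faces pi x y).*2)%N.
have [x xU potx] : exists2 x, x \in U &
    (\sum_(y in U :\ x) pot x y <= #|U :\ x| * #|fixed pi U| + 6)%N.
  have [x /andP[xU pxx]|allfix] := pickP [pred x | (x \in U) && (pi x != x)].
    by exists x => //; exact: sum_potential.
  (* Here [pi] fixes all of [U]: every pairing removes two fixed points and closes one face, so the
     potential does not grow. *)
  have fixU z : z \in U -> pi z = z.
    by move=> zU; have /= := allfix z; rewrite zU => /negbFE/eqP.
  have /card_gt0P[x xU] : (0 < #|U|)%N by rewrite Uk.
  exists x => //; rewrite -sum_nat_const; apply: leq_trans (leq_addr _ _).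
  apply: leq_sum => y yU.
  have /andP[yx yU'] : (y != x) && (y \in U) by move: yU; rewrite in_setD1.
  rewrite /pot closed_faces_fixed ?fixU //; last by rewrite eq_sym.
  have -> : fixed pi U = U.
    by apply/setP=> z; rewrite inE; case: (boolP (z \in U)) => //= /fixU ->; rewrite eqxx.
  rewrite -(cardsD2 xU yU).
  rewrite (_ : 1.*2 = 2)%N // addn2 !ltnS.
  by apply: subset_leq_card; apply/subsetP => z; rewrite inE => /andP[].
have cardx : #|U :\ x| = k.*2.+1.
  by have := cardsD1 x U; rewrite xU Uk doubleS => -[].
rewrite (big_matchings _ xU).
apply: (@le_trans _ _ (\sum_(y in U :\ x) (odd_fact k)%:R *
   (#|~: U|%:R + 3 * harmonic_odd k + (pot x y)%:R / 2))).
  apply: ler_sum => y yU.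
  have /andP[yx yU'] : (y != x) && (y \in U) by move: yU; rewrite in_setD1.
  have Uk' : #|U :\ x :\ y| = k.*2.
    by have := cardsD2 xU yU; rewrite Uk doubleS => -[].
  have xy : x != y by rewrite eq_sym.
  have := IH _ _ Uk' (contract_on xU yU' xy piU).
  have -> : \sum_(L in matchings (U :\ x :\ y)) (#|porbits (L * tperm x y * pi)|%:R : R) =
    \sum_(L in matchings (U :\ x :\ y)) #|porbits (L * contract pi x y)|%:R
    + (odd_fact k)%:R * ((closed_faces pi x y)%:R - 2).
    rewrite -(card_matchings Uk') mulr_natl -sumr_const -big_split /=.
    apply: eq_bigr => L /in_matchings_fix[Lx Ly].
    have /(congr1 (fun n => n%:R : R)) := contract_porbits pi xy Lx Ly.
    rewrite !natrD; lra.
  (* The two points leaving [U] become singletons, which absorbs the 2 of [contract_porbits]. *)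
  have -> : #|~: (U :\ x :\ y)| = (#|~: U| + 2)%N.
    have := cardsC U; have := cardsC (U :\ x :\ y); have := cardsD2 xU yU; lia.
  rewrite -lerBrDr => /le_trans; apply.
  rewrite /pot -muln2; move: (closed_faces pi x y) (odd_fact k) (harmonic_odd k) => g u h.
  by rewrite !natrD natrM le_eqVlt; apply/orP; left; apply/eqP; field.
rewrite -mulr_sumr /odd_fact big_ord_recr /= -/(odd_fact k) natrM -mulrA.
apply: ler_wpM2l; first exact: ler0n.
rewrite big_split /= sumr_const cardx -mulr_suml -natr_sum.
have : (\sum_(y in U :\ x) pot x y)%:R <= (k.*2.+1 * #|fixed pi U| + 6)%:R :> R.
  by rewrite ler_nat -cardx.
rewrite natrD natrM /harmonic_odd big_ord_recr /= -/(harmonic_odd k).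
have K0 : (k.*2.+1%:R : R) != 0 by rewrite pnatr_eq0.
set K : R := k.*2.+1%:R in K0 *; set q := #|~: U|%:R; set h := harmonic_odd k.
set a := #|fixed pi U|%:R; set S := (\sum_(y in U :\ x) pot x y)%:R => le.
rewrite -[(q + 3 * h) *+ _]mulr_natl -/K.
have -> : K * (q + 3 * (h + K^-1) + a / 2) = K * (q + 3 * h) + (K * a + 6) / 2.
  by field; rewrite nat1r.
lra.
Qed.

(* Exponential-moment counterpart of [sum_porbits_le]: a pairing closes a face
   with conditional probability at least 1 / (2j + 1). *)
Lemma sum_exp_porbits_le (s : R) k pi U : 0 < s <= 1 -> #|U| = k.*2 ->
  perm_on U pi ->
  \sum_(L in matchings U) s ^+ #|porbits (L * pi)| <=
  (odd_fact k)%:R * s ^+ #|~: U| * \prod_(j < k) (1 - (1 - s) / (j.*2.+1)%:R).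
Proof.
move=> /andP[s0 s1]; elim: k pi U => [|k IH] pi U Uk piU.
  rewrite (cards0_eq Uk) matchings0 big_set1 mul1g.
  rewrite /odd_fact !big_ord0 mulr1 mul1r.
  have -> : pi = 1%g by apply: (perm_on_id piU); rewrite Uk.
  rewrite setC0 cardsT.
  have -> // : #|porbits (1 : {perm T})%g| = #|T|.
  rewrite /porbits card_imset // => x y e.
  have : x \in porbit 1%g y by rewrite -e porbit_id.
  by case/porbitP => i; rewrite expg1n perm1.
pose P := \prod_(j < k) (1 - (1 - s) / (j.*2.+1)%:R).
have P0 : 0 <= P.
  apply: prodr_ge0 => j _; rewrite subr_ge0 ler_pdivrMr ?ltr0Sn // mul1r.
  by apply: le_trans (_ : 1 <= _); [lra | rewrite ler1n].
pose g := closed_faces pi.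
(* A single closing pair suffices: [y = pi x] if [pi] moves [x], and any pair if [pi] is the
   identity on [U]. *)
have [x xU gx] : exists2 x, x \in U &
    exists2 y, y \in U :\ x & (1 <= g x y)%N.
  have [x /andP[xU pxx]|allfix] := pickP [pred x | (x \in U) && (pi x != x)].
    exists x => //; exists (pi x); first by rewrite !inE pxx (perm_closed _ piU).
    by rewrite /g /closed_faces eqxx addn1 addSn.
  have fixU z : z \in U -> pi z = z.
    by move=> zU; have /= := allfix z; rewrite zU => /negbFE/eqP.
  have /card_gt0P[x xU] : (0 < #|U|)%N by rewrite Uk.
  have /card_gt0P[y yU] : (0 < #|U :\ x|)%N.
    by have := cardsD1 x U; rewrite xU Uk doubleS add1n => -[<-].
  have /andP[yx yU'] : (y != x) && (y \in U) by move: yU; rewrite in_setD1.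
  exists x => //; exists y => //.
  by rewrite /g closed_faces_fixed ?fixU // eq_sym.
have cardx : #|U :\ x| = k.*2.+1.
  by have := cardsD1 x U; rewrite xU Uk doubleS => -[].
rewrite (big_matchings _ xU).
apply: (@le_trans _ _ (\sum_(y in U :\ x)
   (odd_fact k)%:R * s ^+ #|~: U| * P * s ^+ g x y)).
  apply: ler_sum => y yU.
  have /andP[yx yU'] : (y != x) && (y \in U) by move: yU; rewrite in_setD1.
  have Uk' : #|U :\ x :\ y| = k.*2.
    by have := cardsD2 xU yU; rewrite Uk doubleS => -[].
  have xy : x != y by rewrite eq_sym.
  have := IH _ _ Uk' (contract_on xU yU' xy piU); rewrite -/P.
  have -> : #|~: (U :\ x :\ y)| = (#|~: U| + 2)%N.
    have := cardsC U; have := cardsC (U :\ x :\ y); have := cardsD2 xU yU; lia.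
  move=> /(ler_wpM2r (exprn_ge0 (g x y) (ltW s0))) le.
  rewrite -(ler_pM2r (exprn_gt0 2 s0)).
  have -> : (\sum_(L in matchings (U :\ x :\ y)) s ^+ #|porbits (L * tperm x y * pi)|)
    * s ^+ 2 = (\sum_(L in matchings (U :\ x :\ y)) s ^+ #|porbits (L * contract pi x y)|)
    * s ^+ g x y.
    rewrite !mulr_suml; apply: eq_bigr => L /in_matchings_fix[Lx Ly].
    by rewrite -!exprD (contract_porbits pi xy Lx Ly).
  apply: le_trans le _; rewrite exprD; set of_ := (odd_fact k)%:R.
  by rewrite le_eqVlt; apply/orP; left; apply/eqP; ring.
rewrite -mulr_sumr /odd_fact !big_ord_recr /= -/(odd_fact k) -/P natrM.
set K : R := k.*2.+1%:R.
have K0 : 0 < K by rewrite ltr0Sn.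
(* Of the 2k + 1 partners, [y0] contributes at most [s] and each other one at most 1. *)
have sum_le : \sum_(y in U :\ x) s ^+ g x y <= K - (1 - s).
  case: gx => y0 y0U gy0; rewrite (big_setD1 y0) //=.
  have : s ^+ g x y0 <= s by rewrite -{2}[s]expr1 ler_wiXn2l // ltW.
  have : \sum_(i in U :\ x :\ y0) s ^+ g x i <= \sum_(i in U :\ x :\ y0) 1.
    by apply: ler_sum => y _; rewrite exprn_ile1 // ltW.
  rewrite sumr_const.
  have -> : #|U :\ x :\ y0| = k.*2.
    by have := cardsD1 y0 (U :\ x); rewrite y0U cardx => -[].
  rewrite /K -[k.*2.+1]addn1 natrD; lra.
have -> : (odd_fact k)%:R * K * s ^+ #|~: U| * (P * (1 - (1 - s) / K)) =
  (odd_fact k)%:R * s ^+ #|~: U| * P * (K - (1 - s)).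
  by field; rewrite nat1r gt_eqF.
by apply: ler_wpM2l => //; rewrite !mulr_ge0 ?ler0n ?exprn_ge0 // ltW.
Qed.

End Sums.

End Splice.

(** * Simple matchings have positive density *)

Lemma leq_double_count (A B : finType) (SA : {set A}) (SB : {set B})
    (r : A -> B -> bool) lo hi :
  (forall a, a \in SA -> lo <= #|[set b in SB | r a b]|) ->
  (forall b, b \in SB -> #|[set a in SA | r a b]| <= hi) ->
  #|SA| * lo <= #|SB| * hi.
Proof.
move=> loP hiP; rewrite -!sum_nat_const.
apply: (@leq_trans (\sum_(a in SA) \sum_(b in SB | r a b) 1)).
  by apply: leq_sum => a aA; rewrite sum1_card -cardsE; apply: loP.
rewrite (exchange_big_dep (mem SB)) => [|a b _ /andP[]] //=.
apply: leq_sum => b bB; rewrite sum1_card -cardsE.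
by apply: leq_trans (hiP b bB); apply/subset_leq_card/subsetP => a; rewrite !inE bB.
Qed.

Lemma in_matchingsT (T : finType) (L : {perm T}) :
  reflect (forall x, L x != x /\ L (L x) = x) (L \in matchings [set: T]).
Proof.
rewrite inE; apply: (iffP andP) => [[_ /forall_inP LP] x|LP].
  by have /andP[? /eqP ?] := LP x (in_setT x).
split; first by apply/subsetP=> x _; rewrite inE.
by apply/forall_inP=> x _; have [-> ->] := LP x; rewrite eqxx.
Qed.

Lemma tperm_conjE (T : finType) (L : {perm T}) a b x :
  (L ^ tperm a b)%g x = tperm a b (L (tperm a b x)).
Proof. by rewrite -{1}(tpermK a b x) permJ. Qed.

Lemma tperm_conjK (T : finType) (L : {perm T}) a b :
  ((L ^ tperm a b) ^ tperm a b)%g = L.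
Proof. by rewrite -conjgM tperm2 conjg1. Qed.

Lemma matchings_conj (T : finType) (L s : {perm T}) :
  L \in matchings [set: T] -> (L ^ s)%g \in matchings [set: T].
Proof.
move=> /in_matchingsT LP; apply/in_matchingsT => x.
rewrite -(permKV s x) !permJ (inj_eq perm_inj).
by have [-> ->] := LP (s^-1 x)%g.
Qed.

Section Simple.
Variables (D : finType) (V : eqType) (p : D -> V) (d : nat).
Implicit Types (L : {perm D}) (x y a : D).

Let M := matchings [set: D].
Definition fiber x := [set y | p y == p x].
Hypothesis fiber_le : forall x, #|fiber x| <= d.

(* Loops count as parallel: the two darts of a loop join the same vertices. *)
Definition parallel L : {set D} :=
  [set x | [exists y, [&& y != x, p y == p x & p (L y) == p (L x)]]].

Definition simple_matchings := [set L in M | parallel L == set0].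

(** Switching: [x] receives a new partner [z], with [#|D| - 3] choices. From the result [L'] one
    reads off [z] as [L' x], and there are at most [d.+1] candidates for the old [L x]: either it is
    [y], or [y] keeps its partner and [L x] lies at the vertex of [L' y]. *)
Lemma card_parallel_pair x y : y != x ->
  #|[set L in M | p (L y) == p (L x)]| * (#|D| - 3) <= #|M| * d.+1.
Proof.
move=> yx.
apply: (leq_double_count (r := fun L L' => [exists z,
   (z \notin [set x; y; L y]) && (L' == (L ^ tperm (L x) z)%g)])).
  move=> L; rewrite inE => /andP[LM _].
  have /in_matchingsT LP := LM; have [Lxx _] := LP x.
  set Z := [set x; y; L y].
  have : #|[set (L ^ tperm (L x) z)%g | z in ~: Z]| = #|~: Z|.
    apply: card_in_imset => z z'; rewrite !inE !negb_or -!andbA.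
    move=> /and3P[zx _ _] /and3P[z'x _ _] /(congr1 (fun s : {perm D} => s x)).
    rewrite !tperm_conjE [tperm _ z x]tpermD // [tperm _ z' x]tpermD //.
    by rewrite !tpermL.
  have ZC : #|D| - 3 <= #|~: Z|.
    have := cardsC Z; have : #|Z| <= 3; last lia.
    apply: leq_trans (leq_card_setU _ _) _; rewrite cards1 cards2.
    by case: (_ != _).
  move=> e; apply: leq_trans ZC _; rewrite -e; apply/subset_leq_card/subsetP.
  move=> _ /imsetP[z zZ ->]; rewrite inE matchings_conj //=.
  by apply/existsP; exists z; rewrite eqxx andbT -in_setC.
move=> L' L'M.
apply: (@leq_trans #|[set (L' ^ tperm z (L' x))%g | z in y |: fiber (L' y)]|); last first.
  apply: leq_trans (leq_imset_card _ _) _; rewrite cardsU1.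
  by have := fiber_le (L' y); case: (_ \notin _); lia.
apply/subset_leq_card/subsetP=> L; rewrite inE => /andP[].
rewrite inE => /andP[LM /eqP pL] /existsP[z /andP[]]; rewrite !inE !negb_or -!andbA => /and3P[zx zy zLy] /eqP L'E.
have /in_matchingsT LP := LM; have [Lxx _] := LP x.
have L'x : L' x = z by rewrite L'E tperm_conjE [tperm _ z x]tpermD // tpermL.
apply/imsetP; exists (L x); last by rewrite L'x L'E tperm_conjK.
rewrite !inE; have [//|Lxy] := eqVneq (L x) y.
rewrite L'E tperm_conjE [tperm _ z y]tpermD //.
by rewrite tpermD ?pL ?eqxx // (inj_eq perm_inj) eq_sym.
Qed.

(** Union bound over pairs of darts at a common vertex. The resulting mean number of parallel darts
    is bounded in terms of [d] alone once [#|D|] is large. *)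
Lemma sum_parallel_le :
  (\sum_(L in M) #|parallel L|) * (#|D| - 3) <= #|D| * d * (#|M| * d.+1).
Proof.
apply: (@leq_trans ((\sum_x \sum_(y in fiber x :\ x)
    #|[set L in M | p (L y) == p (L x)]|) * (#|D| - 3))).
  rewrite leq_mul2r; apply/orP; right.
  have -> : \sum_x \sum_(y in fiber x :\ x) #|[set L in M | p (L y) == p (L x)]| =
    \sum_(L in M) \sum_x \sum_(y in fiber x :\ x) (p (L y) == p (L x)).
    rewrite exchange_big /=; apply: eq_bigr => x _.
    rewrite exchange_big /=; apply: eq_bigr => y _.
    by rewrite -big_mkcondr /= sum1_card -cardsE.
  apply: leq_sum => L _; rewrite -sum1_card big_mkcond /=.
  apply: leq_sum => x _; rewrite inE; case: existsP => // -[y /and3P[yx pyx pL]].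
  by rewrite (big_setD1 y) ?pL //= !inE yx pyx.
rewrite big_distrl /= -mulnA -sum_nat_const.
apply: leq_sum => x _; rewrite big_distrl /=.
apply: (@leq_trans (\sum_(y in fiber x :\ x) #|M| * d.+1)).
  by apply: leq_sum => y; rewrite !inE => /andP[yx _]; apply: card_parallel_pair.
rewrite sum_nat_const leq_mul2r; apply/orP; right.
by apply: leq_trans (fiber_le x); apply/subset_leq_card/subsetDl.
Qed.

(** The darts based at the vertex of [x] or at one of its neighbours. A switch takes [a] outside
    this set so that the new edge {x, a} is neither a loop nor parallel to an old edge. *)
Definition nearby L x : {set D} :=
  [set a | (p a == p x) || [exists u, (p u == p x) && (p (L u) == p a)]].

Lemma card_nearby L x : #|nearby L x| <= d * d.+1.
Proof.
apply: (@leq_trans #|fiber x :|: \bigcup_(u in fiber x) fiber (L u)|).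
  apply/subset_leq_card/subsetP=> a; rewrite !inE => /orP[->//|].
  move=> /existsP[u /andP[pu pa]]; apply/orP; right.
  by apply/bigcupP; exists u; rewrite inE // eq_sym.
apply: leq_trans (leq_card_setU _ _) _; rewrite mulnS leq_add //.
apply: (@leq_trans (\sum_(u in fiber x) d)); last by rewrite sum_nat_const leq_mul2r fiber_le orbT.
elim/big_rec2: _ => [|u m S _ IH]; first by rewrite cards0.
by apply: leq_trans (leq_card_setU _ _) _; rewrite leq_add.
Qed.

Lemma parallel_inv L x : (forall y, L (L y) = y) ->
  (L x \in parallel L) = (x \in parallel L).
Proof.
move=> LK; have imp y : y \in parallel L -> L y \in parallel L.
  rewrite !inE => /existsP[z /and3P[zy pzy pL]]; apply/existsP; exists (L z).
  by rewrite (inj_eq perm_inj) zy pL !LK pzy.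
by apply/idP/idP; [move=> /imp; rewrite LK | exact: imp].
Qed.

(* Symmetric in the two new edges {x, a} and {y, b}, so that it can be applied to
   both of them. *)
Lemma switch_not_parallel L L' x y a b :
  L x = y -> L a = b -> L b = a -> (forall u, L (L u) = u) ->
  L' x = a -> L' a = x -> L' y = b -> L' b = y ->
  (forall u, u \notin [set x; y; a; b] -> L' u = L u) ->
  p a != p b -> a \notin nearby L x ->
  x \notin parallel L'.
Proof.
move=> Lx La Lb LK L'x L'a L'y L'b L'u pab; rewrite !inE => anb.
apply/existsP => -[u /and3P[ux pu]]; rewrite L'x.
move: anb; rewrite negb_or => /andP[pax /existsPn an].
have [->|uy] := eqVneq u y; first by rewrite L'y eq_sym (negbTE pab).
have [ua|ua] := eqVneq u a; first by rewrite -ua pu in pax.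
have [ub|ub] := eqVneq u b.
  by have := an b; rewrite -{1}ub pu Lb eqxx.
rewrite L'u; last by rewrite !inE !negb_or ux uy ua ub.
by have := an u; rewrite pu /= => /negbTE ->.
Qed.

Lemma switchE L x y a b : L \in M -> L x = y -> L a = b -> a != x -> a != y ->
  let L' := (L ^ tperm y a)%g in
  [/\ L' x = a, L' a = x, L' y = b, L' b = y &
      forall u, u \notin [set x; y; a; b] -> L' u = L u].
Proof.
move=> LM Lx La ax ay L'; have /in_matchingsT LP := LM.
have [yx Ly] := LP x; rewrite Lx in yx Ly.
have [ba Lb] := LP a; rewrite La in ba Lb.
have by_ : b != y by rewrite -La -Lx (inj_eq perm_inj).
have bx : b != x by rewrite -La -Ly (inj_eq perm_inj).
have yb : y != b by rewrite eq_sym.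
have xa : x != a by rewrite eq_sym.
have ya : y != a by rewrite eq_sym.
have xb : x != b by rewrite eq_sym.
have ab : a != b by rewrite eq_sym.
rewrite /L'; split; rewrite ?tperm_conjE.
- by rewrite [tperm _ _ x]tpermD // Lx tpermL.
- by rewrite tpermR Ly tpermD.
- by rewrite tpermL La tpermD.
- by rewrite [tperm _ _ b]tpermD // Lb tpermR.
move=> u; rewrite !inE !negb_or -!andbA => /and4P[ux uy ua ub].
rewrite tperm_conjE [tperm _ _ u]tpermD ?[_ == u]eq_sym //.
by rewrite tpermD // eq_sym; [rewrite -Lx|rewrite -Lb]; rewrite (inj_eq perm_inj).
Qed.

(** The four switched darts stop being parallel. Any other dart parallel after the switch was
    parallel to the same dart before, because the [nearby] conditions prevent that dart from being
    one of the four. *)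
Lemma switch_proper L x a : L \in M -> x \in parallel L ->
  a \notin parallel L -> a \notin nearby L x -> L a \notin nearby L (L x) ->
  parallel (L ^ tperm (L x) a)%g \proper parallel L.
Proof.
move=> LM xP aP an bn; have /in_matchingsT LP := LM.
have LK u : L (L u) = u by case: (LP u).
have ax : a != x by apply: contraNneq aP => ->.
have ay : a != L x by apply: contraNneq aP => ->; rewrite parallel_inv.
(* If [a] lay on a loop, its partner would witness that [a] is parallel. *)
have pab : p a != p (L a).
  apply: contra aP => /eqP pab; rewrite inE; apply/existsP; exists (L a).
  by have [-> _] := LP a; rewrite LK pab eqxx.
have := switchE LM (erefl _) (erefl _) ax ay; set L' := (L ^ _)%g => /=.
move=> [L'x L'a L'y L'b L'u].
have /in_matchingsT L'P : L' \in M by apply: matchings_conj.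
have L'K u : L' (L' u) = u by case: (L'P u).
have xP' : x \notin parallel L'.
  exact: (switch_not_parallel (y := L x) (a := a) (b := L a)).
have yP' : L x \notin parallel L'.
  apply: (switch_not_parallel (y := x) (a := L a) (b := a)) => //.
    by move=> u; rewrite !inE => uN; apply: L'u; rewrite !inE;
      apply: contra uN => /orP[/orP[/orP[]|]|] ->; rewrite ?orbT.
  by rewrite eq_sym.
have aP' : a \notin parallel L' by rewrite -L'x parallel_inv.
have bP' : L a \notin parallel L' by rewrite -L'y parallel_inv.
apply/properP; split; last by exists x.
apply/subsetP=> u uP'.
have uN v : v \notin parallel L' -> u != v by apply: contraNneq => <-.
have ux := uN _ xP'; have uy := uN _ yP'; have ua := uN _ aP'; have ub := uN _ bP'.
have L'uE : L' u = L u by apply: L'u; rewrite !inE !negb_or ux uy ua ub.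
move: uP'; rewrite !inE => /existsP[v /and3P[vu pvu]]; rewrite L'uE => pL.
apply/existsP; exists v; rewrite vu pvu /=.
have nearE w z : z \notin nearby L w -> p u == p w -> p (L u) == p z -> false.
  rewrite inE negb_or => /andP[_ /existsPn/(_ u)] h pu pLu.
  by rewrite pu pLu in h.
have nearE' w z : z \notin nearby L w -> p u == p z -> p (L u) == p w -> false.
  rewrite inE negb_or => /andP[_ /existsPn/(_ (L u))] h pu pLu.
  by rewrite pLu LK pu in h.
have [vx|vx] := eqVneq v x.
  move: pvu pL; rewrite vx L'x eq_sym => pu; rewrite eq_sym => pL.
  by have := nearE _ _ an pu pL.
have [va|va] := eqVneq v a.
  move: pvu pL; rewrite va L'a eq_sym => pu; rewrite eq_sym => pL.
  by have := nearE' _ _ an pu pL.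
have [vy|vy] := eqVneq v (L x).
  move: pvu pL; rewrite vy L'y eq_sym => pu; rewrite eq_sym => pL.
  by have := nearE _ _ bn pu pL.
have [vb|vb] := eqVneq v (L a).
  move: pvu pL; rewrite vb L'b eq_sym => pu; rewrite eq_sym => pL.
  by have := nearE' _ _ bn pu pL.
by rewrite -(L'u v) // !inE !negb_or vx vy va vb.
Qed.

(* Undoing a switch: the old partner [y] of [L' a] was parallel to another
   edge, which survives in [L']. *)
Lemma switch_undo L x a : L \in M -> x \in parallel L ->
  a \notin parallel L -> a \notin nearby L x ->
  let L' := (L ^ tperm (L x) a)%g in L x \in nearby L' (L' a).
Proof.
move=> LM xP aP an; have /in_matchingsT LP := LM.
have LK u : L (L u) = u by case: (LP u).
have ax : a != x by apply: contraNneq aP => ->.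
have ay : a != L x by apply: contraNneq aP => ->; rewrite parallel_inv.
have := switchE LM (erefl _) (erefl _) ax ay; set L' := (L ^ _)%g => /=.
move=> [L'x L'a L'y L'b L'u]; rewrite L'a.
move: an; rewrite inE negb_or => /andP[pax /existsPn an].
move: xP; rewrite !inE => /existsP[u /and3P[ux pu pL]].
have [<-|uy] := eqVneq u (L x); first by rewrite pu.
apply/orP; right; apply/existsP; exists u; rewrite pu /= L'u //.
rewrite !inE !negb_or ux uy /=; apply/andP; split.
  by apply: contraNneq pax => <-.
by apply: contraTneq pu => ->; have := an (L a); rewrite LK eqxx andbT.
Qed.

(** Forward, for one parallel dart [x], at most [j.+1 + 2 * (d * d.+1)] darts are unfit as [a].
    Backward, [a] is guessed in [#|D|] ways and [switch_undo] leaves [d * d.+1] candidates for the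
    old partner of [x]; these two darts recover [L] from [L']. *)
Lemma card_switch_le j :
  #|[set L in M | #|parallel L| == j.+1]| * (#|D| - (j.+1 + 2 * (d * d.+1))) <=
  #|[set L in M | #|parallel L| <= j]| * (#|D| * (d * d.+1)).
Proof.
pose ok L x a := [&& a \notin parallel L, a \notin nearby L x
  & L a \notin nearby L (L x)].
apply: (leq_double_count (r := fun L L' => [exists x in parallel L,
   [exists a, ok L x a && (L' == (L ^ tperm (L x) a)%g)]])).
  move=> L; rewrite inE => /andP[LM /eqP Lj].
  have /in_matchingsT LP := LM.
  have /card_gt0P[x xP] : 0 < #|parallel L| by rewrite Lj.
  have [Lxx _] := LP x.
  pose Z := parallel L :|: nearby L x :|: L @^-1: nearby L (L x).
  have okE a : (a \notin Z) = ok L x a by rewrite !in_setU [X in _ || X]in_set !negb_or -andbA.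
  have : #|[set (L ^ tperm (L x) a)%g | a in ~: Z]| = #|~: Z|.
    have ZN z : z \in ~: Z -> z != x.
      by rewrite in_setC okE => /and3P[h _ _]; apply: contraNneq h => ->.
    apply: card_in_imset => z z' /ZN zx /ZN z'x.
    move=> /(congr1 (fun s : {perm D} => s x)).
    rewrite !tperm_conjE [tperm _ z x]tpermD // [tperm _ z' x]tpermD //.
    by rewrite !tpermL.
  have ZC : #|D| - (j.+1 + 2 * (d * d.+1)) <= #|~: Z|.
    have := cardsC Z; have : #|Z| <= j.+1 + 2 * (d * d.+1); last lia.
    apply: leq_trans (leq_card_setU _ _) _; rewrite mul2n -addnn addnA leq_add //.
      by apply: leq_trans (leq_card_setU _ _) _; rewrite Lj leq_add2l card_nearby.
    by rewrite on_card_preimset ?card_nearby //; exists L => u _; case: (LP u).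
  move=> e; apply: leq_trans ZC _; rewrite -e; apply/subset_leq_card/subsetP.
  move=> _ /imsetP[a aZ ->]; rewrite in_setC okE in aZ.
  have /and3P[aP an bn] := aZ.
  rewrite inE; apply/andP; split.
    rewrite inE matchings_conj //=.
    by rewrite -ltnS -Lj; apply/proper_card/switch_proper.
  by apply/exists_inP; exists x => //; apply/existsP; exists a; rewrite aZ eqxx.
move=> L' _.
pose Q := \bigcup_a [set (L' ^ tperm y a)%g | y in nearby L' (L' a)].
apply: (@leq_trans #|Q|).
  apply/subset_leq_card/subsetP=> L; rewrite inE => /andP[].
  rewrite inE => /andP[LM _] /exists_inP[x xP /existsP[a /andP[/and3P[aP an bn] /eqP L'E]]].
  apply/bigcupP; exists a => //; apply/imsetP; exists (L x); last by rewrite L'E tperm_conjK.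
  by rewrite L'E; apply: switch_undo.
rewrite -sum_nat_const /Q; elim/big_rec2: _ => [|u m S _ IH]; first by rewrite cards0.
apply: leq_trans (leq_card_setU _ _) _; rewrite leq_add //.
by apply: leq_trans (leq_imset_card _ _) _; apply: card_nearby.
Qed.

(** With [K = d * d.+1], the mean number of parallel darts is at most 2K, so by Markov's inequality
    at least half of the matchings have at most 4K of them. Lowering this threshold by one costs a
    factor [1 + 2 * K] through [card_switch_le], and 4K such steps reach the simple matchings. *)
Lemma card_matchings_simple : 12 * (d * d.+1) + 6 <= #|D| ->
  #|M| <= 2 * (1 + 2 * (d * d.+1)) ^ (4 * (d * d.+1)) * #|simple_matchings|.
Proof.
set K := d * d.+1 => ND.
pose Tj j := #|[set L in M | #|parallel L| <= j]|.
have T0 : Tj 0 = #|simple_matchings|.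
  by apply: eq_card => L; rewrite !inE leqn0 cards_eq0.
have TS j : j < 4 * K -> Tj j.+1 <= (1 + 2 * K) * Tj j.
  move=> jJ; have := card_switch_le j; rewrite -/K -/(Tj j).
  have : Tj j.+1 <= #|[set L in M | #|parallel L| == j.+1]| + Tj j.
    rewrite addnC; apply: leq_trans (leq_card_setU _ _).
    apply/subset_leq_card/subsetP=> L; rewrite !inE => /andP[-> /=].
    by rewrite leq_eqVlt ltnS orbC.
  set E := #|[set L in M | #|parallel L| == j.+1]|; set N := #|D| in ND *.
  move=> le1 le2; apply: leq_trans le1 _; rewrite mulnDl mul1n addnC leq_add2l.
  have N0 : 0 < N by lia.
  rewrite -(leq_pmul2l N0).
  apply: (@leq_trans (2 * (E * (N - (j.+1 + 2 * K))))); last by lia.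
  (* As [j.+1 <= 4 * K], this is where [12 * K] in the size bound comes from; the 6 serves
     [N <= 2 * (N - 3)] below. *)
  have : N <= 2 * (N - (j.+1 + 2 * K)) by lia.
  nia.
have TJ j : j <= 4 * K -> Tj j <= (1 + 2 * K) ^ j * Tj 0.
  elim: j => [|j IH] jJ; first by rewrite mul1n.
  apply: leq_trans (TS j jJ) _; rewrite expnS -mulnA leq_mul2l.
  by rewrite IH ?orbT // ltnW.
have := TJ _ (leqnn _); rewrite T0.
set J := 4 * K; set S := #|simple_matchings|; move=> le.
have MJ : #|M| = Tj J + #|[set L in M | J < #|parallel L|]|.
  have -> : Tj J = #|M :&: [set L | #|parallel L| <= J]|.
    by apply: eq_card => L; rewrite !inE.
  rewrite -(cardsID [set L | #|parallel L| <= J] M); congr (_ + _).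
  by apply: eq_card => L; rewrite !inE -ltnNge andbC.
have mk : #|[set L in M | J < #|parallel L|]| * J.+1 <= \sum_(L in M) #|parallel L|.
  rewrite -sum_nat_const.
  under eq_bigl do rewrite inE.
  rewrite big_mkcondr /=; apply: leq_sum => L _.
  by case: ifP.
have := sum_parallel_le.
set N := #|D| in ND *; set s := \sum_(L in M) _ in mk *.
have -> : N * d * (#|M| * d.+1) = N * (K * #|M|) by rewrite /K; lia.
move=> sl.
have sK : s <= 2 * (K * #|M|).
  have N0 : 0 < N by lia.
  rewrite -(leq_pmul2l N0); apply: (@leq_trans (2 * (s * (N - 3)))); last by lia.
  have : N <= 2 * (N - 3) by lia.
  nia.
set e := #|[set L in M | J < #|parallel L|]| in MJ mk.
have : 2 * e <= #|M|.
  have : e * J.+1 <= 2 * (K * #|M|) by apply: leq_trans mk sK.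
  rewrite /J; case: (posnP K) => [->|K0]; first by lia.
  nia.
rewrite -mulnA; lia.
Qed.

End Simple.

(** * Labelled graphs as simple matchings *)

Section ModelDarts.
Variables (n : nat) (t : 'I_n -> nat).

Definition model_dart : finType := {v : 'I_n & 'I_(t v)}.
Notation D := model_dart.
Notation dart v j := (Tagged (i := v) (fun u : 'I_n => 'I_(t u)) j).
Implicit Types (x y : D) (L k : {perm D}) (E : {set {set 'I_n}})
  (g : {ffun D -> vpair n}) (rho : {ffun 'I_n -> {perm vpair n}}).

Definition rotate x : D := dart (tag x) (ordS (tagged x)).

Lemma dart_inj v (j j' : 'I_(t v)) : dart v j = dart v j' -> j = j'.
Proof. by move/eqP; rewrite eq_Tagged => /eqP. Qed.

Lemma rotate_inj : injective rotate.
Proof.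
move=> [v j] [w k] e; have vw : v = w := congr1 tag e.
by case: w / vw k e => k e; have /ordS_inj /= -> := dart_inj e.
Qed.

Definition rotation : {perm D} := perm rotate_inj.

Lemma tag_rotation x : tag (rotation x) = tag x.
Proof. by rewrite permE. Qed.

Lemma rotation_iter v (j : 'I_(t v)) i : exists2 k : 'I_(t v),
  (rotation ^+ i)%g (dart v j) = dart v k & k = (j + i) %% t v :> nat.
Proof.
elim: i => [|i [k rk ki]].
  by exists j; rewrite ?expg0 ?perm1 // addn0 modn_small.
exists (ordS k); first by rewrite expgSr permM rk permE.
by rewrite /= ki addnS -addn1 modnDml addn1.
Qed.

Lemma rotation_transitive x y : tag x = tag y -> exists i, y = (rotation ^+ i)%g x.
Proof.
case: x y => v j [w k] /= vw; case: w / vw k => k.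
(* The shift [k - j], enlarged by [t v] to stay a natural number. *)
exists (k + (t v - j)); have [l -> lE] := rotation_iter j (k + (t v - j)).
congr (dart v _); apply: val_inj; rewrite /= lE.
have := ltn_ord j; have := ltn_ord k => kv jv.
by rewrite (_ : (j + (k + (t v - j)) = k + t v)%N); [rewrite modnDr modn_small | lia].
Qed.

Lemma card_dart_fiber v : #|[set x : D | tag x == v]| = t v.
Proof.
have <- : #|[set dart v j | j in [set: 'I_(t v)]]| = t v.
  by rewrite card_imset ?cardsT ?card_ord //; apply: dart_inj.
apply: eq_card => -[w k]; rewrite !inE /=; apply/eqP/imsetP => [wv|[j _ e]].
  by case: v / wv; exists k; rewrite ?inE.
exact: (congr1 tag e).
Qed.

Lemma card_model_dart : #|D| = \sum_v t v.
Proof.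
rewrite -sum1_card (partition_big (fun x : D => tag x) predT) //=.
by apply: eq_bigr => v _; rewrite -card_dart_fiber cardsE sum1_card.
Qed.

Notation simple := (simple_matchings (fun x : D => tag x)).

Lemma simpleP L : reflect [/\ forall x, L (L x) = x, forall x, tag (L x) != tag x &
    forall x y, tag x = tag y -> tag (L x) = tag (L y) -> x = y]
  (L \in simple).
Proof.
rewrite inE; apply: (iffP andP) => [[/in_matchingsT LP /eqP/setP P0]|[LK Ltag Linj]].
  have inj x y : tag x = tag y -> tag (L x) = tag (L y) -> x = y.
    move=> xy Lxy; apply/eqP/negPn/negP => ne.
    have := P0 y; rewrite !inE => /existsP; case; exists x.
    by rewrite ne xy Lxy !eqxx.
  have LK x : L (L x) = x by case: (LP x).
  split=> // x; apply/eqP => e; have [/eqP[]] := LP x.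
  by apply: inj; rewrite ?LK.
split.
  by apply/in_matchingsT => x; split=> //; apply: contraNneq (Ltag x) => ->.
apply/eqP/setP => x; rewrite !inE; apply/existsP => -[y /and3P[yx /eqP xy /eqP Lxy]].
by move: yx; rewrite (Linj _ _ xy Lxy) eqxx.
Qed.

(** Namings of the darts of [E] by model darts over the same vertex. Surjectivity is not imposed; it
    follows by counting in [labelling_onto]. *)
Definition labellings E : {set {ffun D -> vpair n}} :=
  [set g : {ffun D -> vpair n} | injectiveb g &
     [forall x, ((g x).1 == tag x) && (g x \in darts E)]].

Lemma labellingsP E g :
  reflect [/\ injective g, forall x, (g x).1 = tag x & forall x, g x \in darts E]
    (g \in labellings E).
Proof.
rewrite inE; apply: (iffP andP) => [[/injectiveP gI /forallP gP]|[gI g1 gE]].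
  by split=> // x; have /andP[/eqP] := gP x.
split; first exact/injectiveP.
by apply/forallP=> x; rewrite g1 gE eqxx.
Qed.

(** * Labellings and rotation systems of one graph *)

Section Graph.
Variable E : {set {set 'I_n}}.
Hypothesis EG : E \in graphs_with_degrees t.

Lemma card_darts_at v : #|darts_at E v| = t v.
Proof.
move: EG; rewrite inE => /andP[_ /forallP/(_ v)/eqP <-].
rewrite /degree -[RHS](card_imset _ (_ : injective (pair v))); last by move=> e e' [].
apply: eq_card => -[w e]; rewrite !inE /=; apply/andP/imsetP.
  by move=> [/andP[eE we] /eqP wv]; exists e; rewrite ?wv // inE eE -wv.
by move=> [e']; rewrite inE => /andP[eE ve] [-> ->]; rewrite eE ve.
Qed.

Lemma card_darts : #|darts E| = #|D|.
Proof.
rewrite card_model_dart -sum1_card (partition_big fst predT) //=.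
apply: eq_bigr => v _; rewrite -card_darts_at sum1_card -cardsE.
by apply: eq_card => x; rewrite !inE.
Qed.

Lemma labelling_onto g z : g \in labellings E -> z \in darts E ->
  exists2 x, z = g x & tag x = z.1.
Proof.
move=> /labellingsP[gI g1 gE].
have <- : [set g x | x in [set: D]] = darts E.
  apply/eqP; rewrite eqEcard card_imset // cardsT card_darts leqnn andbT.
  by apply/subsetP => _ /imsetP[x _ ->].
by move=> /imsetP[x _ ->]; exists x.
Qed.

Lemma labelling_exists : exists g, g \in labellings E.
Proof.
pose s v := enum (darts_at E v).
have sE v : size (s v) = t v by rewrite -cardE card_darts_at.
pose z0 (x : D) : vpair n := (tag x, set0).
pose g : {ffun D -> vpair n} := [ffun x => nth (z0 x) (s (tag x)) (tagged x)].
have gs x : g x \in darts_at E (tag x).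
  by rewrite ffunE -mem_enum mem_nth // sE.
have g1 x : (g x).1 = tag x by have := gs x; rewrite inE => /andP[_ /eqP].
exists g; apply/labellingsP; split=> //; last first.
  by move=> x; have := gs x; rewrite inE => /andP[].
move=> x y e; have : tag x = tag y by rewrite -!g1 e.
case: x y e => v j [w k] e /= vw; case: w / vw k e => k.
rewrite !ffunE /= => /eqP; rewrite nth_uniq ?sE ?enum_uniq // => /eqP jk.
by congr (dart v _); apply: val_inj.
Qed.

Definition intertwines g rho := [forall x, g (rotation x) == rho (tag x) (g x)].

(** Relabellings at each vertex. They act on labellings by precomposition, and those commuting with
    [rotation] preserve the rotation system that a labelling carries. *)
Definition fiber_perms : {set {perm D}} := [set k : {perm D} | [forall x, tag (k x) == tag x]].
Definition fiber_centralizer : {set {perm D}} :=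
  [set k : {perm D} in fiber_perms | [forall x, k (rotation x) == rotation (k x)]].

Lemma labellings_torsor g0 : g0 \in labellings E ->
  labellings E = [set [ffun x => g0 (fun_of_perm k x)] | k in fiber_perms].
Proof.
move=> g0L; have /labellingsP[g0I g01 g0E] := g0L.
apply/setP=> h; apply/idP/imsetP => [hL|[k kP ->]].
  have /labellingsP[hI h1 hE] := hL.
  have /fin_all_exists[k kP] : forall x, exists y, g0 y = h x.
    by move=> x; have [y e _] := labelling_onto g0L (hE x); exists y.
  have kI : injective k by move=> x y e; apply: hI; rewrite -!kP e.
  exists (perm kI); last by apply/ffunP=> x; rewrite ffunE permE kP.
  by rewrite inE; apply/forallP=> x; rewrite permE -g01 kP h1.
have {}kP x : tag (k x) = tag x.
  by move: kP; rewrite inE => /forallP/(_ x)/eqP.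
apply/labellingsP; split=> [x y|x|x]; rewrite !ffunE //; last by rewrite g01.
by move/g0I/perm_inj.
Qed.

Lemma comp_labelling_inj g0 : g0 \in labellings E ->
  injective (fun k : {perm D} => [ffun x => g0 (k x)] : {ffun D -> vpair n}).
Proof.
move=> /labellingsP[g0I _ _] k k' /ffunP e; apply/permP => x.
by have := e x; rewrite !ffunE => /g0I.
Qed.

Lemma card_labellings : #|labellings E| = #|fiber_perms|.
Proof.
have [g0 g0L] := labelling_exists.
by rewrite (labellings_torsor g0L) card_imset //; apply: comp_labelling_inj.
Qed.

(** Two labellings that intertwine the same [rho] differ by a relabelling commuting with [rotation];
    hence the count depends neither on [rho] nor on [E]. *)
Lemma card_intertwiners g0 rho : g0 \in labellings E -> intertwines g0 rho ->
  #|[set g in labellings E | intertwines g rho]| = #|fiber_centralizer|.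
Proof.
move=> g0L /forallP int0; have /labellingsP[g0I g01 g0E] := g0L.
rewrite -(card_imset _ (comp_labelling_inj g0L)); apply: eq_card => h.
have intk k : k \in fiber_perms -> intertwines [ffun x => g0 (k x)] rho =
    [forall x, k (rotation x) == rotation (k x)].
  rewrite inE => /forallP kP; apply: eq_forallb => x; rewrite !ffunE.
  by rewrite -(eqP (kP x)) -(eqP (int0 (k x))) (inj_eq g0I).
rewrite inE (labellings_torsor g0L); apply/andP/imsetP.
  by move=> [/imsetP[k kP ->]]; rewrite intk // => kR; exists k; rewrite // inE kP.
move=> [k]; rewrite inE => /andP[kP kR] ->; split; last by rewrite intk.
by apply/imsetP; exists k.
Qed.

Lemma darts_at_sub v z : z \in darts_at E v -> z \in darts E /\ z.1 = v.
Proof. by rewrite inE => /andP[-> /eqP ->]. Qed.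

Lemma rotation_systemsP rho :
  reflect (forall v, perm_on (darts_at E v) (rho v) /\
      forall z, z \in darts_at E v -> porbit (rho v) z = darts_at E v)
    (rho \in rotation_systems E).
Proof.
rewrite inE; apply: (iffP forallP) => H v.
  by have /andP[on /forall_inP oP] := H v; split=> // z /oP/eqP.
by have [on oP] := H v; apply/andP; split=> //; apply/forall_inP => z /oP ->.
Qed.

(** The darts at [v] are named in the order in which [rho v] visits them from a chosen dart
    [b v]. *)
Lemma intertwiner_exists rho : (forall v, 0 < t v) ->
  rho \in rotation_systems E ->
  exists2 g, g \in labellings E & intertwines g rho.
Proof.
move=> t0 /rotation_systemsP rhoP.
have /fin_all_exists[b bP] : forall v, exists z, z \in darts_at E v.
  by move=> v; apply/card_gt0P; rewrite card_darts_at.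
have orb v : porbit (rho v) (b v) = darts_at E v by case: (rhoP v) => _; apply.
have sorb v : #|porbit (rho v) (b v)| = t v by rewrite orb card_darts_at.
pose g : {ffun D -> vpair n} :=
  [ffun x => iter (val (tagged x)) (rho (tag x)) (b (tag x))].
have gs x : g x \in darts_at E (tag x).
  by rewrite ffunE -permX -orb mem_porbit.
have g1 x : (g x).1 = tag x by case: (darts_at_sub (gs x)).
exists g.
  apply/labellingsP; split=> //; last by move=> x; case: (darts_at_sub (gs x)).
  move=> x y e; have : tag x = tag y by rewrite -!g1 e.
  case: x y e => v j [w k] e /= vw; case: w / vw k e => k.
  rewrite !ffunE /= => e; congr (dart v _); apply: val_inj => /=.
  have := uniq_traject_porbit (rho v) (b v); rewrite sorb => u.
  apply/eqP; rewrite -(nth_uniq (b v) _ _ u) ?size_traject //.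
  by rewrite !nth_traject // e.
apply/forallP => -[v j]; rewrite permE !ffunE /=.
have [jv|] := ltnP j.+1 (t v); first by rewrite modn_small.
move=> tj; have e : j.+1 = t v by have := ltn_ord j; lia.
by rewrite e modnn /= -iterS e -sorb iter_porbit.
Qed.

Lemma rotation_unique g rho rho' : g \in labellings E ->
  rho \in rotation_systems E -> rho' \in rotation_systems E ->
  intertwines g rho -> intertwines g rho' -> rho = rho'.
Proof.
move=> gL /rotation_systemsP P /rotation_systemsP P' /forallP i /forallP i'.
apply/ffunP=> v; apply/permP => z.
have [zv|zv] := boolP (z \in darts_at E v); last first.
  by rewrite (out_perm (P v).1 zv) (out_perm (P' v).1 zv).
have [zE z1] := darts_at_sub zv; have [x zx tx] := labelling_onto gL zE.
by rewrite -z1 -tx zx -(eqP (i x)) -(eqP (i' x)).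
Qed.

Lemma intertwines_iter g rho v : intertwines g rho -> forall i x, tag x = v ->
  (rho v ^+ i)%g (g x) = g ((rotation ^+ i)%g x).
Proof.
move=> /forallP int i x <-; elim: i => [|i IH]; first by rewrite !perm1.
rewrite !expgSr !permM IH (eqP (int _)); congr (rho _ _).
by elim: i {IH} => [|i IH]; rewrite ?perm1 // expgSr permM tag_rotation.
Qed.

(** [rotation] is transported along [g]; the default value in [f v] makes it the identity away from
    the darts at [v]. *)
Lemma rotation_exists g : g \in labellings E ->
  exists2 rho, rho \in rotation_systems E & intertwines g rho.
Proof.
move=> gL; have /labellingsP[gI g1 gE] := gL.
pose f v z := if [pick x | (g x == z) && (tag x == v)] is Some x then g (rotation x) else z.
have fg x : f (tag x) (g x) = g (rotation x).
  rewrite /f; case: pickP => [y /andP[/eqP/gI -> //]|/(_ x)].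
  by rewrite !eqxx.
have fI v : injective (f v).
  move=> z z'; rewrite /f.
  case: pickP => [x /andP[/eqP <- /eqP xv]|zN]; case: pickP => [x' /andP[/eqP <- /eqP xv']|zN'] //.
  - by move=> /gI/perm_inj ->.
  - by move=> e; have := zN' (rotation x); rewrite e tag_rotation xv !eqxx.
  - by move=> e; have := zN (rotation x'); rewrite e tag_rotation xv' !eqxx.
pose rho : {ffun 'I_n -> {perm vpair n}} := [ffun v => perm (fI v)].
have int : intertwines g rho.
  by apply/forallP => x; rewrite ffunE permE fg.
have gat x : g x \in darts_at E (tag x) by rewrite inE gE g1 eqxx.
exists rho => //; apply/rotation_systemsP => v.
have on : perm_on (darts_at E v) (rho v).
  apply/subsetP=> z; rewrite inE ffunE permE /f.
  by case: pickP => [x /andP[/eqP <- /eqP <-] _|_]; rewrite ?eqxx.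
split=> // z zv; have [zE z1] := darts_at_sub zv.
have [x zx tx] := labelling_onto gL zE.
apply/setP=> y; apply/idP/idP => [/porbitP[i ->]|yv].
  by elim: i => [|i IH]; rewrite ?perm1 // expgSr permM (perm_closed _ on).
have [yE y1] := darts_at_sub yv; have [x' yx' tx'] := labelling_onto gL yE.
have [i x'E] : exists i, x' = (rotation ^+ i)%g x.
  by apply: rotation_transitive; rewrite tx tx' z1 y1.
apply/porbitP; exists i.
by rewrite yx' x'E zx (intertwines_iter int) // tx z1.
Qed.

(** The factors have disjoint supports, and [rho z.1] keeps [z] at its vertex, so no other factor
    acts on it. *)
Lemma prod_rotations rho z : rho \in rotation_systems E -> z \in darts E ->
  (\prod_(v < n) rho v)%g z = rho z.1 z.
Proof.
move=> /rotation_systemsP P zE.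
have sub (s : seq 'I_n) (y : vpair n) : y \in darts E -> uniq s ->
    (\prod_(v <- s) rho v)%g y = if y.1 \in s then rho y.1 y else y.
  move=> yE; elim: s y yE => [|v s IH] y yE; first by rewrite big_nil perm1.
  move=> /= /andP[vs us]; rewrite big_cons permM inE.
  have yat : y \in darts_at E y.1 by rewrite inE yE eqxx.
  have [yv|yv] := eqVneq y.1 v.
    have : rho v y \in darts_at E v by rewrite (perm_closed _ (P v).1) -yv.
    by move=> /darts_at_sub[rE r1]; rewrite IH // r1 (negbTE vs) yv.
  rewrite (out_perm (P v).1); first by rewrite IH.
  by rewrite inE (negbTE yv) andbF.
by rewrite sub // ?index_enum_uniq // mem_index_enum.
Qed.

(** [g] conjugates [L * rotation] to the face permutation on the darts of [E], and so maps cycles to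
    faces bijectively. *)
Lemma num_faces_model g rho L : g \in labellings E ->
  rho \in rotation_systems E -> intertwines g rho ->
  (forall x, g (L x) = swap_ends (g x)) ->
  num_faces E rho = #|porbits (L * rotation)%g|.
Proof.
move=> gL rhoP /forallP int swapL; have /labellingsP[gI g1 gE] := gL.
rewrite /num_faces; set s := (_ * _)%g.
have sg x : s (g x) = g ((L * rotation)%g x).
  rewrite !permM permE -swapL prod_rotations // g1.
  by rewrite (eqP (int _)).
have sgi i x : (s ^+ i)%g (g x) = g (((L * rotation) ^+ i)%g x).
  by elim: i x => [|i IH] x; rewrite ?perm1 // !expgS permM sg IH !permM.
have orb x : porbit s (g x) = [set g y | y in porbit (L * rotation) x].
  apply/setP=> z; apply/porbitP/imsetP => [[i ->]|[y /porbitP[i ->] ->]].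
    by exists (((L * rotation) ^+ i)%g x); rewrite ?mem_porbit ?sgi.
  by exists i; rewrite sgi.
rewrite -(card_imset _ (imset_inj gI)); apply: eq_card => O.
apply/imsetP/imsetP => [[z zE ->]|[_ /imsetP[x _ ->] ->]].
  have [x -> _] := labelling_onto gL zE.
  by exists (porbit (L * rotation) x); rewrite ?orb // imset_f.
by exists (g x); rewrite ?gE ?orb.
Qed.

(** [L] is [dart_swap] pulled back along [g]. Darts at one vertex whose partners share a vertex
    carry the same edge, so they coincide: this is simplicity. *)
Lemma labelling_matching g : g \in labellings E ->
  exists2 L, L \in simple & forall x, g x = (tag x, [set tag x; tag (L x)]).
Proof.
move=> gL; have /labellingsP[gI g1 gE] := gL.
have Es : simple_graph E by move: EG; rewrite inE => /andP[].
have swapP x := dart_swap_darts Es (gE x).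
have /fin_all_exists[l lP] : forall x, exists y, g y = dart_swap n (g x).
  by move=> x; have [sE _ _] := swapP x; have [y e _] := labelling_onto gL sE; exists y.
have lI : injective l.
  by move=> x y e; apply/gI/(@perm_inj _ (dart_swap n)); rewrite -!lP e.
pose L := perm lI.
have gLE x : g (L x) = dart_swap n (g x) by rewrite permE lP.
have gform x : g x = (tag x, [set tag x; tag (L x)]) /\ tag (L x) != tag x.
  have [sE sne s2] := swapP x; rewrite -gLE in sE sne s2.
  have := gE x; rewrite (surjective_pairing (g x)) g1 !inE /= => /andP[eE xe].
  have tne : tag (L x) != tag x.
    apply: contra sne => /eqP tLx; rewrite (surjective_pairing (g x)).
    by rewrite (surjective_pairing (g (L x))) !g1 tLx s2.
  split=> //; congr pair; apply/eqP; rewrite eq_sym eqEcard.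
  have /eqP -> := forall_inP Es _ eE; rewrite cards2 eq_sym tne andbT.
  apply/subsetP => w; rewrite in_set2 => /orP[]/eqP-> //.
  by move: sE; rewrite inE s2 g1 => /andP[].
exists L; last by move=> x; case: (gform x).
apply/simpleP; split=> [x|x|x y xy Lxy]; last 1 first.
- by apply: gI; rewrite (gform x).1 (gform y).1 xy Lxy.
- by apply: gI; rewrite !gLE !permE swap_endsK.
- by case: (gform x).
Qed.

End Graph.

(** * The labelled graph of a simple matching *)

Definition edge_of L x : {set 'I_n} := [set tag x; tag (L x)].
Definition graph_of L : {set {set 'I_n}} := [set edge_of L x | x in [set: D]].
Definition labelling_of L : {ffun D -> vpair n} := [ffun x => (tag x, edge_of L x)].

Lemma edge_of_inj L x y : L \in simple -> tag x = tag y ->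
  edge_of L x = edge_of L y -> x = y.
Proof.
move=> /simpleP[_ Lt Linj] xy /setP/(_ (tag (L x))); rewrite !in_set2 eqxx orbT.
rewrite -xy (negbTE (Lt x)) /= => /esym/eqP; exact: Linj.
Qed.

Lemma edge_ofL L x : L \in simple -> edge_of L (L x) = edge_of L x.
Proof. by move=> /simpleP[LK _ _]; rewrite /edge_of LK setUC. Qed.

Lemma graph_ofP L : L \in simple -> graph_of L \in graphs_with_degrees t.
Proof.
move=> Ls; have /simpleP[LK Lt Linj] := Ls; rewrite inE; apply/andP; split.
  by apply/forall_inP=> _ /imsetP[x _ ->]; rewrite cards2 (eq_sym (tag x)) Lt.
apply/forallP=> v; rewrite /degree -[t v]card_dart_fiber; apply/eqP.
rewrite -(card_in_imset (f := edge_of L)); last first.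
  move=> x y; rewrite !inE => /eqP xv /eqP yv; apply: edge_of_inj => //.
  by rewrite xv yv.
apply: eq_card => e; rewrite inE; apply/andP/imsetP; last first.
  move=> [x]; rewrite inE => /eqP <- ->.
  by split; [apply: imset_f; rewrite inE | rewrite in_set2 eqxx].
move=> [/imsetP[x _ ->]]; rewrite in_set2 => /orP[]/eqP ->.
  by exists x; rewrite ?inE.
by exists (L x); rewrite ?inE ?edge_ofL.
Qed.

Lemma labelling_ofP L : L \in simple -> labelling_of L \in labellings (graph_of L).
Proof.
move=> Ls; apply/labellingsP; split=> [x y|x|x]; rewrite !ffunE //.
  by case=> xy; apply: edge_of_inj.
rewrite inE /= in_set2 eqxx andbT.
by apply: imset_f; rewrite inE.
Qed.

Lemma labelling_of_swap L x : L \in simple ->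
  labelling_of L (L x) = swap_ends (labelling_of L x).
Proof.
move=> Ls; have /simpleP[LK Lt _] := Ls.
by rewrite !ffunE edge_ofL // /edge_of swap_endsE // eq_sym.
Qed.

(** Together with [labelled_graph_inj], this is the bijection between simple matchings and labelled
    graphs. *)
Lemma labelled_graphs_image :
  [set (graph_of L, labelling_of L) | L in simple] =
  [set Eg | (Eg.1 \in graphs_with_degrees t) && (Eg.2 \in labellings Eg.1)].
Proof.
apply/setP=> -[E g]; rewrite [RHS]inE /=; apply/imsetP/andP.
  by move=> [L Ls [-> ->]]; rewrite graph_ofP ?labelling_ofP.
move=> [EG gL]; have [L Ls gE] := labelling_matching EG gL.
have e : g = labelling_of L by apply/ffunP=> x; rewrite gE ffunE.
exists L => //; congr pair => //.
have Es : simple_graph E by move: EG; rewrite inE => /andP[].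
apply/setP=> e'; apply/idP/imsetP => [eE|[x _ ->]].
  have /cards2P[a [b [ab e'E]]] := forall_inP Es _ eE.
  have : (a, e') \in darts E by rewrite inE eE e'E in_set2 eqxx.
  by move=> /(labelling_onto EG gL)[x]; rewrite gE => -[_ ->]; exists x; rewrite ?inE.
have /labellingsP[_ _ /(_ x)] := gL.
by rewrite gE inE => /andP[].
Qed.

Lemma labelled_graph_inj :
  {in simple &, injective (fun L => (graph_of L, labelling_of L))}.
Proof.
move=> L L' Ls Ls' [_ e]; apply/permP=> x.
have /labellingsP[gI _ _] := labelling_ofP Ls.
by apply: gI; rewrite labelling_of_swap // e -labelling_of_swap.
Qed.

End ModelDarts.

(** * The expected number of faces *)

Local Open Scope ring_scope.

Notation simple_model t := (simple_matchings (fun x : model_dart t => tag x)).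

(** Double counting of triples (E, g, rho) with [g] intertwining [rho]: the pairs (E, g) are the
    simple matchings, and for fixed [E] and [rho] the number of [g] is constant. *)
Lemma sum_simple_model (R : pzSemiRingType) (n : nat) (t : 'I_n -> nat)
    (h : {set {set 'I_n}} -> {ffun 'I_n -> {perm vpair n}} -> R) :
  (forall v, 0 < t v)%N ->
  \sum_(L in simple_model t)
    \sum_(rho in rotation_systems (graph_of L) | intertwines (labelling_of L) rho)
      h (graph_of L) rho =
  \sum_(E in graphs_with_degrees t)
    #|fiber_centralizer t|%:R * \sum_(rho in rotation_systems E) h E rho.
Proof.
move=> t0; pose H (Eg : {set {set 'I_n}} * {ffun model_dart t -> vpair n}) :=
  \sum_(rho in rotation_systems Eg.1 | intertwines Eg.2 rho) h Eg.1 rho.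
transitivity (\sum_(Eg in [set (graph_of L, labelling_of L) | L in simple_model t]) H Eg).
  by rewrite (big_imset _ (@labelled_graph_inj _ t)).
rewrite labelled_graphs_image.
under eq_bigl do rewrite inE.
rewrite -(pair_big_dep (mem (graphs_with_degrees t)) (fun E g => g \in labellings t E)
  (fun E g => H (E, g))) /=.
apply: eq_bigr => E EG; rewrite /H /=.
rewrite (exchange_big_dep (mem (rotation_systems E))) => [|g rho _ /andP[]] //=.
rewrite mulr_sumr; apply: eq_bigr => rho rhoE.
have [g gL int] := intertwiner_exists EG t0 rhoE.
rewrite -(card_intertwiners EG gL int) mulr_natl -sumr_const.
by apply: eq_bigl => g'; rewrite [RHS]in_set rhoE.
Qed.

(** Pairs of a labelling and its rotation system are counted in both orders. All graphs thus have
    equally many rotation systems, which turns the average of averages in [expected_faces] into one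
    uniform average. *)
Lemma card_rotation_systems (n : nat) (t : 'I_n -> nat) (E : {set {set 'I_n}}) :
  (forall v, 0 < t v)%N -> E \in graphs_with_degrees t ->
  (#|fiber_centralizer t| * #|rotation_systems E| = #|fiber_perms t|)%N.
Proof.
move=> t0 EG; rewrite -(card_labellings EG) mulnC.
pose I := fun rho (g : {ffun model_dart t -> vpair n}) => intertwines g rho.
transitivity (\sum_(rho in rotation_systems E) \sum_(g in labellings t E | I rho g) 1)%N.
  rewrite -sum_nat_const; apply: eq_bigr => rho rhoE.
  have [g gL int] := intertwiner_exists EG t0 rhoE.
  by rewrite -(card_intertwiners EG gL int) -sum1_card; apply: eq_bigl => g'; rewrite inE.
rewrite (exchange_big_dep (mem (labellings t E))) => [|g rho _ /andP[]] //=.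
rewrite -sum1_card; apply: eq_bigr => g gL.
have [rho rhoE int] := rotation_exists EG gL.
rewrite (big_pred1 rho) // => rho'; apply/andP/eqP => [[rho'E /andP[_ int']]|->].
  exact: (rotation_unique EG gL).
by split => //; rewrite gL.
Qed.

Lemma expected_faces_model (R : realType) (n : nat) (t : 'I_n -> nat) :
  (forall v, 0 < t v)%N ->
  expected_faces R t =
  average (simple_model t) (fun L => #|porbits (L * rotation t)|%:R).
Proof.
move=> t0; rewrite /expected_faces /average.
have unique (L : {perm model_dart t}) (f : _ -> R) : L \in simple_model t -> exists rho,
  [/\ rho \in rotation_systems (graph_of L), intertwines (labelling_of L) rho &
   \sum_(rho in rotation_systems (graph_of L) | intertwines (labelling_of L) rho)
      f rho = f rho].
  move=> Ls; have EG := graph_ofP Ls; have gL := labelling_ofP Ls.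
  have [rho rhoE int] := rotation_exists EG gL; exists rho; split => //.
  rewrite (big_pred1 rho) // => rho'; apply/andP/eqP => [[rho'E int']|-> //].
  exact: (rotation_unique EG gL).
have K0 : (#|fiber_centralizer t|%:R : R) != 0.
  rewrite pnatr_eq0 -lt0n; apply/card_gt0P; exists 1%g; rewrite !inE.
  by apply/andP; split; apply/forallP => x; rewrite !perm1.
have Q0 : (#|fiber_perms t|%:R : R) != 0.
  rewrite pnatr_eq0 -lt0n; apply/card_gt0P; exists 1%g; rewrite !inE.
  by apply/forallP => x; rewrite !perm1.
have -> : \sum_(L in simple_model t) (#|porbits (L * rotation t)|%:R : R) =
    \sum_(E in graphs_with_degrees t)
    #|fiber_centralizer t|%:R * \sum_(rho in rotation_systems E) (num_faces E rho)%:R.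
  rewrite -sum_simple_model //; apply: eq_bigr => L Ls.
  have [rho [rhoE int ->]] := unique L (fun rho => (num_faces (graph_of L) rho)%:R) Ls.
  congr (_%:R); symmetry; apply: (num_faces_model (graph_ofP Ls) (labelling_ofP Ls)) => //.
  by move=> x; apply: labelling_of_swap.
have rotE E : E \in graphs_with_degrees t ->
    #|rotation_systems E|%:R = #|fiber_perms t|%:R / #|fiber_centralizer t|%:R :> R.
  move=> EG; rewrite -(card_rotation_systems t0 EG) natrM; by field.
have -> : (#|simple_model t|%:R : R) = #|fiber_perms t|%:R * #|graphs_with_degrees t|%:R.
  rewrite -sum1_card natr_sum.
  transitivity (\sum_(E in graphs_with_degrees t)
    (#|fiber_centralizer t|%:R * \sum_(rho in rotation_systems E) 1 : R)).
    rewrite -(sum_simple_model (fun _ _ => 1)) //; apply: eq_bigr => L Ls.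
    by have [rho [_ _ ->]] := unique L (fun=> 1) Ls.
  rewrite [RHS]mulr_natr -[RHS]sumr_const; apply: eq_bigr => E EG.
  by rewrite sumr_const rotE //; field.
rewrite invfM mulrA; congr (_ / _).
rewrite mulr_suml; apply: eq_bigr => E EG; rewrite rotE // invf_div.
by rewrite mulrCA mulrA.
Qed.

Lemma simple_model_gt0 (n : nat) (t : 'I_n -> nat) :
  graphical t -> (0 < #|simple_model t|)%N.
Proof.
move=> [E EG]; have [g gL] := labelling_exists EG.
by have [L Ls _] := labelling_matching EG gL; apply/card_gt0P; exists L.
Qed.

(** Serves to deduce that the number of darts is even from the existence of a simple matching. *)
Lemma card_matchings_odd (T : finType) (U : {set T}) :
  odd #|U| -> #|matchings U| = 0%N.
Proof.
have [k] := ubnP #|U|; elim: k U => // k IH U Uk oU.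
have /card_gt0P[x xU] : (0 < #|U|)%N by case: #|U| oU.
have := big_matchings (fun=> 1%N) xU; rewrite sum1_card => ->.
rewrite big1 // => y yU; rewrite sum1_card; have c2 := cardsD2 xU yU.
apply: IH; first by move: Uk; rewrite -c2; lia.
by move: oU; rewrite -c2 /= negbK.
Qed.

(** All cycles of [rotation] have length at least 2, so exposure starts with zero potential. *)
Lemma fixed_rotation (n : nat) (t : 'I_n -> nat) (U : {set model_dart t}) :
  (forall v, 2 <= t v)%N -> #|fixed (rotation t) U| = 0%N.
Proof.
move=> t2; apply/eqP; rewrite cards_eq0; apply/eqP/setP => -[v j].
rewrite !inE permE /=; apply/negP => /andP[_ /eqP e].
have /(congr1 val) /= := dart_inj e.
have := t2 v; have := ltn_ord j => jt t2v.
have [jt'|tj] := ltnP j.+1 (t v); first by rewrite modn_small //; lia.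
have -> : j.+1 = t v by lia.
by rewrite modnn; lia.
Qed.

(** * Comparison of odd harmonic sums with logarithms *)

Section Analysis.
Variable R : realType.

Lemma ln_succ_le (k : nat) : ln (k.+2%:R : R) <= ln k.+1%:R + k.+1%:R^-1.
Proof.
have k0 : 0 < (k.+1%:R : R) by rewrite ltr0Sn.
have -> : (k.+2%:R : R) = k.+1%:R * (1 + k.+1%:R^-1).
  by rewrite mulrDr mulr1 mulfV ?gt_eqF // natr1.
rewrite lnM ?posrE //; last by rewrite addr_gt0 ?invr_gt0.
by rewrite lerD2l; apply: le_ln1Dx; apply: lt_trans (_ : 0 < _); rewrite ?invr_gt0 // ltrN10.
Qed.

Lemma le_ln_succ (k : nat) : ln (k.+1%:R : R) + k.+2%:R^-1 <= ln k.+2%:R.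
Proof.
have k0 : 0 < (k.+1%:R : R) by rewrite ltr0Sn.
have k20 : 0 < (k.+2%:R : R) by rewrite ltr0Sn.
have i1 : (k.+2%:R^-1 : R) < 1 by rewrite invf_lt1 // ltr1n.
have e : (k.+1%:R : R) = k.+2%:R * (1 - k.+2%:R^-1).
  by rewrite mulrBr mulr1 mulfV ?gt_eqF // -[k.+2%:R]natr1; ring.
rewrite {1}e lnM ?posrE //; last by rewrite subr_gt0.
have : ln (1 - k.+2%:R^-1) <= - k.+2%:R^-1 :> R by apply: le_ln1Dx; rewrite ltrN2.
by move=> h; rewrite -addrA gerDl -lerBrDr sub0r.
Qed.

Lemma harmonic_odd_ge (k : nat) : ln k.+1%:R / 2 <= harmonic_odd R k.
Proof.
elim: k => [|k IH]; first by rewrite /harmonic_odd big_ord0 ln1 mul0r.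
rewrite /harmonic_odd big_ord_recr /= -/(harmonic_odd R k).
have := ln_succ_le k.
have : (k.+1%:R^-1 : R) / 2 <= k.*2.+1%:R^-1.
  rewrite -invfM lef_pV2 ?posrE ?mulr_gt0 ?ltr0Sn // -natrM ler_nat; lia.
by move: IH; move: (ln _) (ln _) k.+1%:R^-1 k.*2.+1%:R^-1 (harmonic_odd R k) => l1 l2 i1 i2 h; lra.
Qed.

Lemma harmonic_odd_le (k : nat) : harmonic_odd R k.+1 <= 1 + ln k.+1%:R.
Proof.
elim: k => [|k IH]; first by rewrite /harmonic_odd big_ord1 invr1 ln1 addr0.
rewrite /harmonic_odd big_ord_recr /= -/(harmonic_odd R k.+1).
have := le_ln_succ k.
have : (k.+1.*2.+1%:R^-1 : R) <= k.+2%:R^-1.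
  by rewrite lef_pV2 ?posrE ?ltr0Sn // ler_nat; lia.
by move: IH; move: (ln _) (ln _) k.+2%:R^-1 k.+1.*2.+1%:R^-1 (harmonic_odd R _) => l1 l2 i1 i2 h; lra.
Qed.

Lemma prod_le_expR (c : R) k : 0 <= c <= 1 ->
  \prod_(j < k) (1 - c / j.*2.+1%:R) <= expR (- (c * harmonic_odd R k)).
Proof.
move=> /andP[c0 c1]; elim: k => [|k IH].
  by rewrite /harmonic_odd !big_ord0 mulr0 oppr0 expR0.
rewrite /harmonic_odd !big_ord_recr /= -/(harmonic_odd R k) [c * (_ + _)]mulrDr opprD expRD.
have le1 : c / k.*2.+1%:R <= 1.
  rewrite ler_pdivrMr ?ltr0Sn // mul1r; apply: le_trans c1 _.
  by rewrite ler1n.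
apply: ler_pM => //; last exact: expR_ge1Dx.
  apply: prodr_ge0 => j _; rewrite subr_ge0 ler_pdivrMr ?ltr0Sn // mul1r.
  by apply: le_trans c1 _; rewrite ler1n.
by rewrite subr_ge0.
Qed.

End Analysis.

(** Face numbers are nonnegative, so the sum over simple matchings is at most the sum over all;
    their density 1 / [C0] then costs the factor [C0]. *)
Lemma average_faces_upper (R : realType) (n : nat) (t : 'I_n -> nat) (C0 : R) k :
  #|model_dart t| = k.*2 -> (forall v, 2 <= t v)%N -> (0 < #|simple_model t|)%N ->
  #|matchings [set: model_dart t]|%:R <= C0 * #|simple_model t|%:R ->
  average (simple_model t) (fun L => #|porbits (L * rotation t)|%:R) <=
  C0 * (3 * harmonic_odd R k).
Proof.
move=> Nk t2 S0 MS; rewrite /average ler_pdivrMr ?ltr0n //.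
apply: (@le_trans _ _ (\sum_(L in matchings [set: model_dart t]) #|porbits (L * rotation t)|%:R)).
  rewrite [leRHS](bigID (mem (simple_model t))) /=.
  rewrite [X in _ <= X + _](_ : _ = \sum_(L in simple_model t) #|porbits (L * rotation t)|%:R).
    by rewrite lerDl; apply: sumr_ge0 => L _; apply: ler0n.
  by apply: eq_bigl => L; rewrite [L \in simple_model t]inE andbA andbb.
have Tk : #|[set: model_dart t]| = k.*2 by rewrite cardsT.
have piT : perm_on [set: model_dart t] (rotation t) by apply/subsetP=> x _; rewrite inE.
have := sum_porbits_le R Tk piT.
rewrite -(card_matchings Tk) setCT cards0 fixed_rotation // mul0r addr0 add0r.
move/le_trans; apply; rewrite mulrAC ler_wpM2r //.
by rewrite mulr_ge0 // sumr_ge0 // => j _; rewrite invr_ge0.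
Qed.

(* Jensen's inequality for [exp (- F)] over the simple matchings, in the form
   of its tangent line at [lam]. *)
Lemma average_faces_lower (R : realType) (n : nat) (t : 'I_n -> nat) (C0 : R) k :
  #|model_dart t| = k.*2 -> (0 < #|simple_model t|)%N ->
  #|matchings [set: model_dart t]|%:R <= C0 * #|simple_model t|%:R ->
  harmonic_odd R k / 2 - C0 <=
  average (simple_model t) (fun L => #|porbits (L * rotation t)|%:R).
Proof.
move=> Nk S0 MS; rewrite /average ler_pdivlMr ?ltr0n //.
pose s : R := expR (-1).
have s0 : 0 < s by apply: expR_gt0.
have s2 : s <= 1 / 2.
  rewrite /s expRN div1r lef_pV2 ?posrE ?expR_gt0 //.
  by apply: le_trans (expR_ge1Dx 1).
have h0 : 0 <= harmonic_odd R k by apply: sumr_ge0 => j _; rewrite invr_ge0.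
(* Chosen so that [expR (- lam)] bounds the mean of [exp (- F)] over all matchings. *)
pose lam := (1 - s) * harmonic_odd R k.
have lamh : harmonic_odd R k / 2 <= lam by rewrite /lam mulrC ler_wpM2r //; lra.
have Tk : #|[set: model_dart t]| = k.*2 by rewrite cardsT.
have piT : perm_on [set: model_dart t] (rotation t) by apply/subsetP=> x _; rewrite inE.
have s01 : 0 < s <= 1 by rewrite s0; lra.
have := sum_exp_porbits_le s01 Tk piT.
rewrite -(card_matchings Tk) setCT cards0 expr0 mulr1 => le.
have c01 : 0 <= 1 - s <= 1 by apply/andP; split; lra.
have le2 : \sum_(L in simple_model t) s ^+ #|porbits (L * rotation t)| <=
    C0 * #|simple_model t|%:R * expR (- lam).
  apply: le_trans (_ : _ <= \sum_(L in matchings [set: model_dart t])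
    s ^+ #|porbits (L * rotation t)|) _.
    rewrite [leRHS](bigID (mem (simple_model t))) /=.
    rewrite [X in _ <= X + _](_ : _ = \sum_(L in simple_model t) s ^+ #|porbits (L * rotation t)|).
      by rewrite lerDl; apply: sumr_ge0 => L _; rewrite exprn_ge0 // ltW.
    by apply: eq_bigl => L; rewrite [L \in simple_model t]inE andbA andbb.
  apply: le_trans le _; apply: (@le_trans _ _ (#|matchings [set: model_dart t]|%:R * expR (- lam))).
    by rewrite ler_wpM2l ?ler0n // prod_le_expR.
  by rewrite ler_wpM2r ?expR_ge0.
have tangent (f : nat) : expR (- lam) * (1 + lam - f%:R) <= s ^+ f.
  have e : - f%:R = - lam + (lam - f%:R) :> R by ring.
  rewrite /s -expRM_natl mulrN mulr1 [in leRHS]e expRD -addrA.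
  by rewrite ler_wpM2l ?expR_ge0 // expR_ge1Dx.
have le3 : expR (- lam) * ((1 + lam) * #|simple_model t|%:R -
    \sum_(L in simple_model t) #|porbits (L * rotation t)|%:R) <=
    expR (- lam) * (C0 * #|simple_model t|%:R).
  rewrite [leRHS]mulrC; apply: le_trans le2.
  rewrite [_ * #|_|%:R]mulr_natr -sumr_const -sumrB mulr_sumr.
  by apply: ler_sum => L _; apply: tangent.
rewrite ler_pM2l ?expR_gt0 // in le3.
set F := \sum_(L in _) _ in le3 *; set S : R := #|simple_model t|%:R in le3 *.
have S0' : 0 <= S by apply: ler0n.
have : (harmonic_odd R k / 2) * S <= lam * S by apply: ler_wpM2r.
lra.
Qed.

Theorem theorem1p12 (R : realType) (d : nat) (eps : R)
    (hd : (2 <= d)%N) (heps : 0 < eps) :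
  exists (c C : R) (n0 : nat), 0 < c /\ 0 < C /\
    forall (n : nat) (t : 'I_n -> nat),
      (n0 <= n)%N ->
      graphical t ->
      (forall i : 'I_n, (2 <= t i <= d)%N) ->
      (1 + eps) * n%:R <= half_degree_sum R t ->
      c * ln n%:R <= expected_faces R t /\
      expected_faces R t <= C * ln n%:R.
Proof.
pose A := (2 * (1 + 2 * (d * d.+1)) ^ (4 * (d * d.+1)))%N; pose C0 : R := A%:R.
have C01 : 1 <= C0 by rewrite ler1n muln_gt0 expn_gt0.
have [n1 n1P] : exists n1 : nat, expR (8 * C0) <= n1%:R.
  exists (Num.bound (expR (8 * C0))).
  by apply/ltW; have := archi_boundP (expR_ge0 (8 * C0)).
(* [n1] makes [C0 <= ln n / 8], so the lower bound [ln n / 4 - C0] is at least [ln n / 8]. For the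
   upper constant, [1 + ln (k + 1) <= 1 + d + ln n <= (d + 2) * ln n], as [ln n >= 1]. The other
   threshold meets the size bound of [card_matchings_simple]. *)
exists (1 / 8), (3 * C0 * (d%:R + 2)), (maxn n1 (12 * (d * d.+1) + 6)).
split; first lra; split.
  have d0 : (0 : R) <= d%:R by apply: ler0n.
  by apply: mulr_gt0; [apply: mulr_gt0|]; lra.
move=> n t; rewrite geq_max => /andP[n1n dn] tG td _.
have t2 v : (2 <= t v)%N by case/andP: (td v).
have t0 v : (0 < t v)%N by apply: leq_trans (t2 v).
rewrite expected_faces_model //.
have S0 := simple_model_gt0 tG.
have Nn : (2 * n <= #|model_dart t| <= d * n)%N.
  rewrite card_model_dart -[X in (_ * X <= _ <= _ * X)%N]card_ord.
  rewrite mulnC [(d * _)%N]mulnC -!sum_nat_const.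
  by apply/andP; split; apply: leq_sum => v _; case/andP: (td v).
have MS0 : (#|matchings [set: model_dart t]| <= A * #|simple_model t|)%N.
  apply: card_matchings_simple; last by lia.
  by move=> x; rewrite card_dart_fiber; case/andP: (td (tag x)).
have MS : #|matchings [set: model_dart t]|%:R <= C0 * #|simple_model t|%:R.
  by rewrite -natrM ler_nat.
have [k Nk] : exists k, #|model_dart t| = k.+1.*2.
  have oN : ~~ odd #|model_dart t|.
    apply: contraL S0 => oN; rewrite -leqNgt.
    have := @card_matchings_odd _ [set: model_dart t]; rewrite cardsT => /(_ oN) <-.
    by apply/subset_leq_card/subsetP => L; rewrite inE => /andP[].
  exists (#|model_dart t|./2.-1).
  have := even_halfK oN; lia.
have n0 : 0 < (n%:R : R) by rewrite ltr0n; lia.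
have lnn : 8 * C0 <= ln n%:R.
  rewrite -ler_expR lnK ?posrE //; apply: le_trans n1P _.
  by rewrite ler_nat.
split.
  apply: le_trans (average_faces_lower Nk S0 MS).
  have := harmonic_odd_ge R k.+1.
  have : ln n%:R <= ln (k.+2%:R : R).
    by rewrite ler_ln ?posrE ?ltr0Sn // ler_nat; lia.
  lra.
apply: le_trans (average_faces_upper Nk t2 S0 MS) _.
have lnk : ln (k.+1%:R : R) <= d%:R + ln n%:R.
  have d0 : 0 < (d%:R : R) by rewrite ltr0n; lia.
  have : ln (k.+1%:R : R) <= ln (d%:R * n%:R).
    by rewrite ler_ln ?posrE ?ltr0Sn ?mulr_gt0 // -natrM ler_nat; lia.
  rewrite lnM ?posrE //.
  have := @le_ln1Dx R (d%:R - 1); rewrite addrCA subrr addr0 => lnd.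
  have : ln (d%:R : R) <= d%:R - 1 by apply: lnd; lra.
  lra.
have h := harmonic_odd_le R k.
rewrite -!mulrA mulrCA ler_wpM2l // ler_wpM2l; [|lra|].
  lra.
have d0 : 0 <= (d%:R : R) by apply: ler0n.
apply: (@le_trans _ _ ((d%:R + 1) * 1 + ln n%:R)); first lra.
have : (d%:R + 1) * 1 <= (d%:R + 1) * ln n%:R :> R by apply: ler_wpM2l; lra.
lra.
Qed.
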